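(* Let $\ell\ge2$. Then $$\widetilde L_{A_{2\ell-1}^{(1)}}(-\Lambda_0)=\widetilde L_{C_\ell^{(1)}}(-\Lambda_0)\oplus\widetilde L_{C_\ell^{(1)}}(-2\Lambda_0+\Lambda_2).$$ In particular, $$\widetilde L_{C_\ell^{(1)}}(-\Lambda_0)=\widetilde L_{A_{2\ell-1}^{(1)}}(-\Lambda_0)^0,\qquad \widetilde L_{C_\ell^{(1)}}(-2\Lambda_0+\Lambda_2)=\widetilde L_{A_{2\ell-1}^{(1)}}(-\Lambda_0)^1,$$ where the superscripts $0$ and $1$ denote the $+1$- and $-1$-eigenspaces of the automorphism $\theta$ defined in the context.
   Context: All vertex algebras are over $\mathbb C$. Weyl vertex algebra $M_{2\ell}$: the algebra with generators $a_i^\pm(r)$, $r\in\tfrac12+\mathbb Z$, $1\le i\le2\ell$, and only non-trivial relations $[a_i^+(r),a_j^-(s)]=\delta_{r+s,0}\delta_{i,j}$ has an irreducible module $M_{2\ell}$ generated by $\mathbf 1$ with $a_i^\pm(r)\mathbf 1=0$ for $r>0$; the fields $a_i^\pm(z)=\sum_{n\in\mathbb Z}a_i^\pm(n+\tfrac12)z^{-n-1}$ generate on it a unique simple vertex algebra structure. $\widetilde L_{A_{2\ell-1}^{(1)}}(-\Lambda_0)$ is the vertex subalgebra of $M_{2\ell}$ generated by $a_i^+(-\tfrac12)a_j^-(-\tfrac12)\mathbf 1$ and $a_i^-(-\tfrac12)a_j^+(-\tfrac12)\mathbf 1$, $1\le i<j\le2\ell$; it is an affine vertex operator algebra of level $-1$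 of type $A_{2\ell-1}^{(1)}$. $\widetilde L_{C_\ell^{(1)}}(-\Lambda_0)\subset\widetilde L_{A_{2\ell-1}^{(1)}}(-\Lambda_0)$ is the vertex subalgebra generated by $a_i^+(-\tfrac12)a_{2\ell+1-i}^-(-\tfrac12)\mathbf 1$, $a_i^-(-\tfrac12)a_{2\ell+1-i}^+(-\tfrac12)\mathbf 1$ $(1\le i\le\ell)$ and, for $1\le i<j\le\ell$, $\tfrac12(a_i^+(-\tfrac12)a_{2\ell+1-j}^-(-\tfrac12)+a_j^+(-\tfrac12)a_{2\ell+1-i}^-(-\tfrac12))\mathbf 1$, $\tfrac12(a_i^-(-\tfrac12)a_{2\ell+1-j}^+(-\tfrac12)+a_j^-(-\tfrac12)a_{2\ell+1-i}^+(-\tfrac12))\mathbf 1$, $\tfrac12(a_i^+(-\tfrac12)a_j^-(-\tfrac12)-a_{2\ell+1-j}^+(-\tfrac12)a_{2\ell+1-i}^-(-\tfrac12))\mathbf 1$, $\tfrac12(a_j^+(-\tfrac12)a_i^-(-\tfrac12)-a_{2\ell+1-i}^+(-\tfrac12)a_{2\ell+1-j}^-(-\tfrac12))\mathbf 1$; it is an affine vertex operator algebra of level $-1$ of type $C_\ell^{(1)}$. $\widetilde L_{C_\ell^{(1)}}(-2\Lambda_0+\Lambda_2)$ denotes the $\widetilde L_{C_\ell^{(1)}}(-\Lambda_0)$-submodule of $\widetilde L_{A_{2\ell-1}^{(1)}}(-\Lambda_0)$ generated by the vector $e^*_{\epsilon_1+\epsilon_2}=\tfrac12(a_1^+(-\tfrac12)a_{2\ell-1}^-(-\tfrac12)-a_2^+(-\tfrac12)a_{2\ell}^-(-\tfrac12))\mathbf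 1$, which is a singular vector for the affine Lie algebra of type $C_\ell^{(1)}$ of weight $-2\Lambda_0+\Lambda_2$. $\theta$ is the automorphism of $M_{2\ell}$ lifted from $a_i^+(s)\mapsto a_{2\ell+1-i}^-(s)$, $a_{2\ell+1-i}^-(s)\mapsto a_i^+(s)$, $a_i^-(s)\mapsto-a_{2\ell+1-i}^+(s)$, $a_{2\ell+1-i}^+(s)\mapsto-a_i^-(s)$, $i=1,\dots,\ell$, $s\in\tfrac12+\mathbb Z$; it preserves $\widetilde L_{A_{2\ell-1}^{(1)}}(-\Lambda_0)$. For a $\theta$-stable subalgebra $U$, $U^0=\{u\in U\mid\theta(u)=u\}$ and $U^1=\{u\in U\mid\theta(u)=-u\}$. *)

(* Defs.v *)
(* The field of complex numbers is R[i], for R : realType. *)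
From mathcomp Require Import all_boot all_order all_algebra.
From mathcomp Require Import all_classical all_reals.
From mathcomp Require Export complex.

Set Implicit Arguments.
Unset Strict Implicit.
Unset Printing Implicit Defensive.

Import Order.TTheory GRing.Theory Num.Theory.

Local Open Scope classical_set_scope.
Local Open Scope ring_scope.

Definition is_subspace (F : numFieldType) (V : lmodType F) (U : set V) : Prop :=
  GRing.submod_closed [in U].

(* W is the internal direct sum of U and N. *)
Definition is_direct_sum (F : numFieldType) (V : lmodType F) (W U N : set V)
    : Prop :=
  W = [set u + v | u in U & v in N] /\ U `&` N = [set 0].

(* m (m - 1) ... (m - j + 1) / j! for an arbitrary integer m. *)
Definition gbinom (F : numFieldType) (m : int) (j : nat) : F :=
  (\prod_(i < j) (m - i%:Z)%:~R) / j`!%:R.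

(* [vmul u n v] is the coefficient u_(n) v of z^(-n-1) in Y(u, z) v.  The last
   axiom is the component form of the Jacobi identity (Borcherds identity).  Its
   two sums over j >= 0 have finitely many nonzero terms by [vmul_trunc]; they
   are cut at any K beyond which every term vanishes. *)
Record vertex_algebra (F : numFieldType) (V : lmodType F) := VertexAlgebra {
  vmul : V -> int -> V -> V;
  vac : V;
  vmul_linearl : forall (n : int) (v : V), linear (fun u => vmul u n v);
  vmul_linearr : forall (u : V) (n : int), linear (vmul u n);
  vmul_trunc : forall u v : V,
    exists N : int, forall n : int, N <= n -> vmul u n v = 0;
  vmul_vacl : forall (n : int) (v : V),
    vmul vac n v = if n == -1 then v else 0;
  vmul_vacr_ge0 : forall (u : V) (n : int), 0 <= n -> vmul u n vac = 0;
  vmul_vacrN1 : forall u : V, vmul u (-1) vac = u;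
  vmul_borcherds : forall (u v w : V) (l m n : int) (K : nat),
    (forall j : nat, (K <= j)%N ->
       [/\ vmul u (l + j%:Z) v = 0,
           vmul v (n + j%:Z) w = 0 &
           vmul u (m + j%:Z) w = 0]) ->
    \sum_(j < K) gbinom F m j *: vmul (vmul u (l + j%:Z) v) (m + n - j%:Z) w =
    \sum_(j < K) ((-1) ^+ j * gbinom F l j) *:
      (vmul u (m + l - j%:Z) (vmul v (n + j%:Z) w)
       - (-1) ^ l *: vmul v (n + l - j%:Z) (vmul u (m + j%:Z) w))
}.

Section VertexAlgebraTheory.
Variables (F : numFieldType) (V : lmodType F) (Y : vertex_algebra V).

Definition is_vertex_subalgebra (U : set V) : Prop :=
  [/\ is_subspace U,
      U (vac Y) &
      forall (u v : V) (n : int), U u -> U v -> U (vmul Y u n v)].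

Definition vertex_subalgebra_gen (S : set V) : set V :=
  smallest is_vertex_subalgebra S.

(* N is a submodule of W, where the vertex subalgebra U of W acts on W by
   restriction of Y. *)
Definition is_submodule (U W N : set V) : Prop :=
  [/\ is_subspace N,
      N `<=` W &
      forall (u v : V) (n : int), U u -> N v -> N (vmul Y u n v)].

Definition submodule_gen (U W : set V) (S : set V) : set V :=
  smallest (is_submodule U W) S.

Definition is_va_automorphism (f : {linear V -> V}) : Prop :=
  [/\ bijective f,
      f (vac Y) = vac Y &
      forall (u v : V) (n : int), f (vmul Y u n v) = vmul Y (f u) n (f v)].

End VertexAlgebraTheory.

(* The operators of the Weyl algebra are indexed by half-integers; [wp i n] and
   [wm i n] are a_i^+(n + 1/2) and a_i^-(n + 1/2), so that [wp i n] is also the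
   coefficient of z^(-n-1) in the field a_i^+(z), and [wp i (-1)] is
   a_i^+(-1/2). *)
Definition weyl_stable (F : numFieldType) (V : lmodType F) (k : nat)
    (wp wm : 'I_k -> int -> {linear V -> V}) (N : set V) : Prop :=
  is_subspace N /\
  forall (i : 'I_k) (n : int) (v : V), N v -> N (wp i n v) /\ N (wm i n v).

(* The last two axioms say Y(a_i^(+-)(-1/2) 1, z) = a_i^(+-)(z). *)
Record weyl_vertex_algebra (F : numFieldType) (k : nat) := WeylVertexAlgebra {
  weyl_space :> lmodType F;
  weyl_va : vertex_algebra weyl_space;
  wp : 'I_k -> int -> {linear weyl_space -> weyl_space};
  wm : 'I_k -> int -> {linear weyl_space -> weyl_space};
  weyl_comm_pm : forall (i j : 'I_k) (m n : int) (v : weyl_space),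
    wp i m (wm j n v) - wm j n (wp i m v) =
      if (m + n + 1 == 0) && (i == j) then v else 0;
  weyl_comm_pp : forall (i j : 'I_k) (m n : int) (v : weyl_space),
    wp i m (wp j n v) = wp j n (wp i m v);
  weyl_comm_mm : forall (i j : 'I_k) (m n : int) (v : weyl_space),
    wm i m (wm j n v) = wm j n (wm i m v);
  weyl_vacp : forall (i : 'I_k) (n : int), 0 <= n -> wp i n (vac weyl_va) = 0;
  weyl_vacm : forall (i : 'I_k) (n : int), 0 <= n -> wm i n (vac weyl_va) = 0;
  weyl_cyclic : smallest (weyl_stable wp wm) [set vac weyl_va] = setT;
  weyl_neq0 : exists v : weyl_space, v <> 0;
  weyl_irreducible : forall N : set weyl_space,
    weyl_stable wp wm N -> N = [set 0] \/ N = setT;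
  weyl_fieldp : forall (i : 'I_k) (n : int) (v : weyl_space),
    vmul weyl_va (wp i (-1) (vac weyl_va)) n v = wp i n v;
  weyl_fieldm : forall (i : 'I_k) (n : int) (v : weyl_space),
    vmul weyl_va (wm i (-1) (vac weyl_va)) n v = wm i n v
}.

Arguments wp {F k w}.
Arguments wm {F k w}.

Section WeylSubalgebras.
Variables (F : numFieldType) (l : nat) (M : weyl_vertex_algebra F (2 * l)).

Local Notation Y := (weyl_va M).

(* The mode index -1 stands for the half-integer -1/2. *)
Definition qpm (i j : 'I_(2 * l)) : M := wp i (-1) (wm j (-1) (vac Y)).
Definition qmp (i j : 'I_(2 * l)) : M := wm i (-1) (wp j (-1) (vac Y)).

Definition genA : set M :=
  [set v | exists i j : 'I_(2 * l),
     (i < j)%N /\ (v = qpm i j \/ v = qmp i j)].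

Definition LA : set M := vertex_subalgebra_gen Y genA.

(* Ordinals are 0-based: 1 <= i <= l becomes i < l, and the index 2l + 1 - i
   becomes [rev_ord i]. *)
Definition genC_long : set M :=
  [set v | exists i : 'I_(2 * l),
     (i < l)%N /\ (v = qpm i (rev_ord i) \/ v = qmp i (rev_ord i))].

Definition genC_short : set M :=
  [set v | exists i j : 'I_(2 * l),
     [/\ (i < j)%N, (j < l)%N &
       [\/ v = 2^-1 *: (qpm i (rev_ord j) + qpm j (rev_ord i)),
           v = 2^-1 *: (qmp i (rev_ord j) + qmp j (rev_ord i)),
           v = 2^-1 *: (qpm i j - qpm (rev_ord j) (rev_ord i)) |
           v = 2^-1 *: (qpm j i - qpm (rev_ord i) (rev_ord j))]]].

Definition LC : set M := vertex_subalgebra_gen Y (genC_long `|` genC_short).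

Fact lt0_2l : (2 <= l)%N -> (0 < 2 * l)%N.
Proof. by case: l. Qed.

Fact lt1_2l : (2 <= l)%N -> (1 < 2 * l)%N.
Proof. by move=> hl; apply: leq_trans hl _; rewrite leq_pmull. Qed.

(* The vector e^*_(epsilon_1 + epsilon_2); the indices 1 and 2 are the ordinals
   0 and 1. *)
Definition estar (hl : (2 <= l)%N) : M :=
  let i1 := Ordinal (lt0_2l hl) in
  let i2 := Ordinal (lt1_2l hl) in
  2^-1 *: (qpm i1 (rev_ord i2) - qpm i2 (rev_ord i1)).

(* - 2 Lambda_0 + Lambda_2 is the weight of the generator [estar]. *)
Definition LC2 (hl : (2 <= l)%N) : set M := submodule_gen Y LC LA [set estar hl].

Definition is_theta (theta : {linear M -> M}) : Prop :=
  is_va_automorphism Y theta /\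
  forall (i : 'I_(2 * l)) (n : int) (v : M), (i < l)%N ->
    [/\ theta (wp i n v) = wm (rev_ord i) n (theta v),
        theta (wm (rev_ord i) n v) = wp i n (theta v),
        theta (wm i n v) = - wp (rev_ord i) n (theta v) &
        theta (wp (rev_ord i) n v) = - wm i n (theta v)].

End WeylSubalgebras.

Arguments LA {F l} M.
Arguments LC {F l} M.
Arguments LC2 {F l} M hl.

Definition fixed_part (F : numFieldType) (V : lmodType F)
    (f : {linear V -> V}) (U : set V) : set V := [set u | U u /\ f u = u].

Definition anti_part (F : numFieldType) (V : lmodType F)
    (f : {linear V -> V}) (U : set V) : set V := [set u | U u /\ f u = - u].

(* Main.v *)
From HB Require Import structures.
Require Import Defs.
From mathcomp Require Import all_boot all_order all_algebra.
From mathcomp Require Import all_classical all_reals.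
From mathcomp Require Import ring zify.

Set Implicit Arguments.
Unset Strict Implicit.
Unset Printing Implicit Defensive.

Import Order.TTheory GRing.Theory Num.Theory.

Local Open Scope classical_set_scope.
Local Open Scope ring_scope.

(** Write J(a, b) for the currents of sp(2l), symmetric in a, b, and B(a, b) for
the currents of its complement in sl(2l), antisymmetric and of trace zero for
the symplectic form.  The J generate LC and, by the action of their zero modes,
LC2 is the LC-module generated by all the B.  Let T be the translation operator.

The sum LC + LC2 contains the generators of LA, so LA is this sum as soon as
LC + LC2 is closed under all products.  Because J and B satisfy the commutation
relations of a symmetric pair, this reduces to two facts about the generators
([extension_subalgebra]): T B lies in LC2, and B_(n) B' lies in LC for all n.

- The first is [odd_translation_formula], the Sugawara formula for the action
  of T on the primary vectors B.  It is checked in the free bosons, where the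
  quartic terms cancel at level -1; this cancellation is the conformal embedding
  of LC in LA.
- For n >= 0 the second is a commutation relation.  For n < 0, applying the mode
  B_(m), m = n + 1 <= 0, to the formula for T B' shows that B_(m-1) B', modulo
  LC, is an eigenvector for eigenvalue - m of the mixed Casimir operator on the
  tensor square of the span W of the B.  This is the fusion rule argument: a
  component of highest weight mu can only appear in conformal weight h_mu.  The
  components of W (x) W have weights h among 0, 1, 1 + 1/l, 2 - 2/l, 2, 2 + 1/l,
  whereas B_(m-1) B' has conformal weight 2 - m >= 2.  So only h = 2 and m = 0
  remain; this component is in the exterior square of W, on which the product of
  index -1 is a commutator, and commutators are in LC.  The decomposition of
  W (x) W is replaced by explicit linear algebra ([swap_eigenvector_closed]).

That LC and LC2 meet in 0 is a matter of parity, and needs an operator which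
exists without any theta.  Let psi_i be a_i^+ and psi*_i be a_(2l+1-i)^- up to
sign.  After the change of basis p = psi + psi*, q = psi - psi*, the J are
combinations of pp and qq, and the generator of LC2 is a combination of pq.  There
is a weight one vector whose zero mode is a derivation that kills every p and has
eigenvalue 1 or -1 on every q.  Its eigenvalues are even on LC and odd on LC2.

Finally an automorphism theta as in the statement fixes every J and negates the
generator of LC2, so it is 1 on LC and -1 on LC2. *)

(** * Linear identities in modules *)

(** The square-zero extension of F by V is a commutative ring into which V embeds,
so that linear identities between vectors become polynomial identities. *)
Definition sqzero (F : comNzRingType) (V : lmodType F) : Type := (F * V)%type.

Section SquareZero.
Variables (F : comNzRingType) (V : lmodType F).
Local Notation E := (sqzero V).
HB.instance Definition _ := GRing.Zmodule.on E.

Definition sqzero_one : E := (1, 0).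
Definition sqzero_mul (x y : E) : E := (x.1 * y.1, x.1 *: y.2 + y.1 *: x.2).

Fact sqzero_mulA : associative sqzero_mul.
Proof.
move=> [a u] [b v] [c w]; rewrite /sqzero_mul /= mulrA !scalerDr !scalerA addrA.
by rewrite (mulrC c a) (mulrC c b).
Qed.
Fact sqzero_mulC : commutative sqzero_mul.
Proof. by move=> [a u] [b v]; rewrite /sqzero_mul /= mulrC addrC. Qed.
Fact sqzero_mul1 : left_id sqzero_one sqzero_mul.
Proof. by move=> [a u]; rewrite /sqzero_mul /= mul1r scale1r scaler0 addr0. Qed.
Fact sqzero_mulDl : left_distributive sqzero_mul +%R.
Proof.
move=> [a u] [b v] [c w]; rewrite /sqzero_mul /= mulrDl scalerDl scalerDr.
by congr (_, _); rewrite /= addrACA.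
Qed.
Fact sqzero_neq0 : sqzero_one != 0 :> E.
Proof. by apply/eqP => -[] /eqP; rewrite oner_eq0. Qed.
HB.instance Definition _ := GRing.Zmodule_isComNzRing.Build E
  sqzero_mulA sqzero_mulC sqzero_mul1 sqzero_mulDl sqzero_neq0.

Definition sqz_scalar (a : F) : E := (a, 0).
Definition sqz_vector (v : V) : E := (0, v).

Fact sqz_scalar_is_additive : zmod_morphism sqz_scalar.
Proof. by move=> a b; congr pair; rewrite /= subr0. Qed.
HB.instance Definition _ :=
  GRing.isZmodMorphism.Build F E sqz_scalar sqz_scalar_is_additive.
Fact sqz_scalar_is_multiplicative : monoid_morphism sqz_scalar.
Proof. by split=> // a b; congr pair; rewrite /= !scaler0 addr0. Qed.
HB.instance Definition _ :=
  GRing.isMonoidMorphism.Build F E sqz_scalar sqz_scalar_is_multiplicative.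
Lemma sqz_vector0 : sqz_vector 0 = 0. Proof. by []. Qed.
Lemma sqz_vectorD u v : sqz_vector (u + v) = sqz_vector u + sqz_vector v.
Proof. by congr pair; rewrite /= addr0. Qed.
Lemma sqz_vectorN v : sqz_vector (- v) = - sqz_vector v.
Proof. by congr pair; rewrite /= oppr0. Qed.
Lemma sqz_vectorMn v n : sqz_vector (v *+ n) = sqz_vector v *+ n.
Proof. by elim: n => // n IH; rewrite !mulrS sqz_vectorD IH. Qed.
Lemma sqz_vectorZ a v : sqz_vector (a *: v) = sqz_scalar a * sqz_vector v.
Proof. by congr pair; rewrite /= ?mulr0 // scale0r addr0. Qed.
Lemma sqz_vector_inj : injective sqz_vector.
Proof. by move=> u v []. Qed.
End SquareZero.

Ltac lmodule_ring :=
  apply: sqz_vector_inj;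
  rewrite ?(sqz_vectorZ, sqz_vector0, sqz_vectorD, sqz_vectorN, sqz_vectorMn);
  ring.

(** * Subspaces, binomials and the component calculus of vertex algebras *)
Section Subspace.
Variables (F : numFieldType) (V : lmodType F).

Lemma subspaceP (S : set V) :
  is_subspace S <->
  S 0 /\ forall (a : F) u v, S u -> S v -> S (a *: u + v).
Proof.
split=> [[S0 Sl]|[S0 Sl]]; split; rewrite ?inE // in S0 *.
  by move=> a u v Su Sv; have := Sl a u v; rewrite !inE; apply.
by move=> a u v; rewrite !inE; apply: Sl.
Qed.

Variables (S : set V) (hS : is_subspace S).

Lemma subspace0 : S 0.
Proof. by have /subspaceP[] := hS. Qed.
Lemma subspaceZ a u : S u -> S (a *: u).
Proof.
move=> Su; have /subspaceP[S0 Sl] := hS.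
by rewrite -[a *: u]addr0; apply: Sl.
Qed.
Lemma subspaceD u v : S u -> S v -> S (u + v).
Proof.
by move=> Su Sv; have /subspaceP[S0 Sl] := hS; rewrite -[u]scale1r; apply: Sl.
Qed.
Lemma subspaceN u : S u -> S (- u).
Proof. by rewrite -scaleN1r; apply: subspaceZ. Qed.
Lemma subspaceB u v : S u -> S v -> S (u - v).
Proof. by move=> Su Sv; apply/subspaceD/subspaceN. Qed.
Lemma subspace_sum (I : Type) (r : seq I) (P : pred I) (f : I -> V) :
  (forall i, P i -> S (f i)) -> S (\sum_(i <- r | P i) f i).
Proof.
by move=> Sf; apply: big_ind Sf => //; [exact: subspace0 | exact: subspaceD].
Qed.
Lemma subspace_scaleI a u : a != 0 -> S (a *: u) -> S u.
Proof. by move=> a0 /(subspaceZ a^-1); rewrite scalerA mulVf // scale1r. Qed.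
End Subspace.

Section Binomials.
Variable F : numFieldType.

Lemma gbinom0 m : gbinom F m 0 = 1.
Proof. by rewrite /gbinom big_ord0 fact0 divr1. Qed.
Lemma gbinom1 m : gbinom F m 1 = m%:~R.
Proof. by rewrite /gbinom big_ord_recl big_ord0 subr0 mulr1 divr1. Qed.
Lemma gbinom0n j : gbinom F 0 j = (j == 0%N)%:R.
Proof.
case: j => [|j]; first exact: gbinom0.
by rewrite /gbinom big_ord_recl subr0 !mul0r.
Qed.
Lemma gbinomN1 j : gbinom F (-1) j = (-1) ^+ j.
Proof.
rewrite /gbinom.
have -> : \prod_(i < j) (-1 - i%:Z)%:~R = (-1) ^+ j * j`!%:R :> F.
  elim: j => [|j IH]; first by rewrite big_ord0 mul1r.
  rewrite big_ord_recr /= IH factS exprS natrM intrB; ring.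
by rewrite mulfK // pnatr_eq0 -lt0n fact_gt0.
Qed.
End Binomials.

Section VertexAlgebra.
Variables (F : numFieldType) (V : lmodType F) (Y : vertex_algebra V).
Local Notation one := (vac Y).

Lemma vmulDl u v n w : vmul Y (u + v) n w = vmul Y u n w + vmul Y v n w.
Proof. by rewrite -[u]scale1r (vmul_linearl Y n w) !scale1r. Qed.
Lemma vmulDr u n v w : vmul Y u n (v + w) = vmul Y u n v + vmul Y u n w.
Proof. by rewrite -[v]scale1r (vmul_linearr Y u n) !scale1r. Qed.
Lemma vmul0l n w : vmul Y 0 n w = 0.
Proof. by apply: (addrI (vmul Y 0 n w)); rewrite -vmulDl !addr0. Qed.
Lemma vmul0r u n : vmul Y u n 0 = 0.
Proof. by apply: (addrI (vmul Y u n 0)); rewrite -vmulDr !addr0. Qed.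
Lemma vmulZl a u n w : vmul Y (a *: u) n w = a *: vmul Y u n w.
Proof. by rewrite -[a *: u]addr0 (vmul_linearl Y n w) vmul0l addr0. Qed.
Lemma vmulZr u n a w : vmul Y u n (a *: w) = a *: vmul Y u n w.
Proof. by rewrite -[a *: w]addr0 (vmul_linearr Y u n) vmul0r addr0. Qed.
Lemma vmulNl u n w : vmul Y (- u) n w = - vmul Y u n w.
Proof. by rewrite -scaleN1r vmulZl scaleN1r. Qed.
Lemma vmulNr u n w : vmul Y u n (- w) = - vmul Y u n w.
Proof. by rewrite -scaleN1r vmulZr scaleN1r. Qed.
Lemma vmul_suml I (r : seq I) (P : pred I) (f : I -> V) n w :
  vmul Y (\sum_(i <- r | P i) f i) n w = \sum_(i <- r | P i) vmul Y (f i) n w.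
Proof.
by apply: (big_morph (fun u => vmul Y u n w)) => [u v|]; rewrite (vmulDl, vmul0l).
Qed.
Lemma vmul_sumr I (r : seq I) (P : pred I) (f : I -> V) u n :
  vmul Y u n (\sum_(i <- r | P i) f i) = \sum_(i <- r | P i) vmul Y u n (f i).
Proof.
by apply: (big_morph (vmul Y u n)) => [v w|]; rewrite (vmulDr, vmul0r).
Qed.

Lemma vmul_trunc_nat u v n :
  exists K : nat, forall j, (K <= j)%N -> vmul Y u (n + j%:Z) v = 0.
Proof.
have [N hN] := vmul_trunc Y u v; exists `|N - n|%N => j hj.
by apply: hN; lia.
Qed.

(** Truncation makes both sides finite, and a bound on the summation range can
always be enlarged; this form avoids choosing the bound in each application. *)
Lemma borcherds_large u v w (l m n : int) :
  exists K0 : nat, forall K, (K0 <= K)%N ->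
    \sum_(j < K) gbinom F m j *:
       vmul Y (vmul Y u (l + j%:Z) v) (m + n - j%:Z) w =
    \sum_(j < K) ((-1) ^+ j * gbinom F l j) *:
      (vmul Y u (m + l - j%:Z) (vmul Y v (n + j%:Z) w)
       - (-1) ^ l *: vmul Y v (n + l - j%:Z) (vmul Y u (m + j%:Z) w)).
Proof.
have [K1 h1] := vmul_trunc_nat u v l.
have [K2 h2] := vmul_trunc_nat v w n.
have [K3 h3] := vmul_trunc_nat u w m.
exists (K1 + K2 + K3)%N => K hK; apply: vmul_borcherds => j hj.
by split; [apply: h1 | apply: h2 | apply: h3]; lia.
Qed.

Lemma big_ord_trunc (f : nat -> V) K K' : (K <= K')%N ->
  (forall j, (K <= j)%N -> f j = 0) -> \sum_(j < K') f j = \sum_(j < K) f j.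
Proof.
move=> hK f0; rewrite (big_ord_widen _ f hK) [RHS]big_mkcond /=.
by apply: eq_bigr => j _; case: ltnP => // /f0.
Qed.

(** The case l = 0 of the Borcherds identity.  The bound K only concerns the
products of u and v, since the terms of the right hand side vanish with them. *)
Lemma commutator u v w (m n : int) K :
  (forall j, (K <= j)%N -> vmul Y u j%:Z v = 0) ->
  vmul Y u m (vmul Y v n w) - vmul Y v n (vmul Y u m w) =
  \sum_(j < K) gbinom F m j *: vmul Y (vmul Y u j%:Z v) (m + n - j%:Z) w.
Proof.
move=> hK; have [K0 h0] := borcherds_large u v w 0 m n.
have := h0 (K0 + K).+1 ltac:(lia).
rewrite [RHS]big_ord_recl [X in _ = _ + X]big1 => [|j _]; last first.
  by rewrite gbinom0n mulr0 scale0r.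
rewrite !(addr0, subr0) gbinom0 mulr1 expr0z !scale1r => <-.
rewrite -(big_ord_trunc (K := K) (K' := (K0 + K).+1)
  (f := fun j : nat => gbinom F m j *: vmul Y (vmul Y u j%:Z v) (m + n - j%:Z) w)).
- by apply: eq_bigr => j _; rewrite add0r.
- by lia.
- by move=> j /hK->; rewrite vmul0l scaler0.
Qed.

Lemma commutator_primary u v w (m n : int) :
  (forall j : int, 0 < j -> vmul Y u j v = 0) ->
  vmul Y u m (vmul Y v n w) =
  vmul Y v n (vmul Y u m w) + vmul Y (vmul Y u 0 v) (m + n) w.
Proof.
move=> hu; rewrite -[LHS](subrK (vmul Y v n (vmul Y u m w))) addrC.
rewrite (@commutator _ _ _ _ _ 1) => [|j j1]; last by apply: hu; lia.
by rewrite big_ord1 gbinom0 scale1r subr0.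
Qed.

Lemma vmul0_derivation z u n v :
  vmul Y z 0 (vmul Y u n v) =
  vmul Y (vmul Y z 0 u) n v + vmul Y u n (vmul Y z 0 v).
Proof.
have [K hK] := vmul_trunc_nat z u 0.
rewrite -[LHS](subrK (vmul Y u n (vmul Y z 0 v))); congr (_ + _).
rewrite (@commutator _ _ _ _ _ K.+1) => [|j Kj]; last first.
  by rewrite -[j%:Z]add0r; apply: hK; lia.
rewrite big_ord_recl big1 => [|j _]; last by rewrite gbinom0n scale0r.
by rewrite gbinom0 scale1r add0r subr0 addr0.
Qed.

(** The case m = 0 of the Borcherds identity. *)
Lemma associator_large u v w (l n : int) :
  exists K0 : nat, forall K, (K0 <= K)%N ->
    vmul Y (vmul Y u l v) n w =
    \sum_(j < K) ((-1) ^+ j * gbinom F l j) *: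
      (vmul Y u (l - j%:Z) (vmul Y v (n + j%:Z) w)
       - (-1) ^ l *: vmul Y v (n + l - j%:Z) (vmul Y u j%:Z w)).
Proof.
have [K0 h0] := borcherds_large u v w l 0 n.
exists K0.+1 => -[|K] // hK; have := h0 K.+1 ltac:(lia).
rewrite big_ord_recl big1 => [|j _]; last by rewrite gbinom0n scale0r.
rewrite gbinom0 scale1r !(addr0, add0r, subr0) => ->.
by apply: eq_bigr => j _; rewrite !add0r.
Qed.

(** The modes of a_(-1) b are those of the normally ordered product of fields. *)
Lemma normal_order_large a b c (n : int) :
  exists K0 : nat, forall K, (K0 <= K)%N ->
    vmul Y (vmul Y a (-1) b) n c =
    \sum_(j < K) (vmul Y a (-1 - j%:Z) (vmul Y b (n + j%:Z) c)
                  + vmul Y b (n - 1 - j%:Z) (vmul Y a j%:Z c)).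
Proof.
have [K0 h0] := associator_large a b c (-1) n; exists K0 => K /h0 ->.
apply: eq_bigr => j _; rewrite gbinomN1 -expr2 sqrr_sign scale1r.
by rewrite exprN1 invrN1 scaleN1r opprK.
Qed.

(** [vmul Y v (-2) one] is T v, so this is the rule [T, u_(n)] = - n u_(n-1); it is
the Borcherds identity on the vacuum, where only two terms survive. *)
Lemma translation u n v :
  vmul Y (vmul Y u n v) (-2) one =
  vmul Y u n (vmul Y v (-2) one) - n%:~R *: vmul Y u (n - 1) v.
Proof.
have [K0 h0] := borcherds_large u v one n 0 (-2).
have := h0 K0.+2 ltac:(lia).
rewrite big_ord_recl big1 => [|j _]; last by rewrite gbinom0n scale0r.
rewrite gbinom0 scale1r !(addr0, add0r, subr0) => ->.
rewrite !big_ord_recl big1 => [|j _]; last first.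
  rewrite [X in vmul Y u _ X]vmul_vacr_ge0 ?[X in vmul Y v _ X]vmul_vacr_ge0.
  - by rewrite !vmul0r !(scaler0, subr0).
  - by rewrite /=; lia.
  - by rewrite /= /bump; lia.
rewrite /= gbinom0 gbinom1 !(addr0, add0r, subr0) !expr0 expr1 !mul1r scale1r.
rewrite (_ : bump 0 0 = 1%N) // !(@vmul_vacr_ge0 _ _ _ u) // !vmul0r !scaler0.
rewrite !subr0.
have -> : -2 + 1%N%:Z = -1 by [].
by rewrite vmul_vacrN1 mulN1r scaleNr.
Qed.

Lemma translation_vac : vmul Y one (-2) one = 0.
Proof. by rewrite vmul_vacl. Qed.

Section Closure.
Variables (S : set V) (hS : is_subspace S).

Lemma associator_closed u v w (l n : int) :
  (forall p q, S (vmul Y u p (vmul Y v q w))) ->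
  (forall p q, S (vmul Y v p (vmul Y u q w))) ->
  S (vmul Y (vmul Y u l v) n w).
Proof.
move=> huv hvu; have [K h] := associator_large u v w l n.
rewrite (h K) //; apply: subspace_sum => // j _.
by apply: subspaceZ => //; apply: subspaceB => //; apply: subspaceZ.
Qed.

(** To check that a subspace is stable under a vertex subalgebra it is therefore
enough to look at generators of the latter. *)
Lemma stabilizer_subalgebra (S' := [set u | forall n v, S v -> S (vmul Y u n v)]) :
  is_vertex_subalgebra Y S'.
Proof.
split.
- apply/subspaceP; split=> [n v _|a u v hu hv n w Sw].
    by rewrite vmul0l; apply: subspace0.
  rewrite vmulDl vmulZl.
  by apply: subspaceD; [|apply: subspaceZ; [|apply: hu] | apply: hv].
- by move=> n v Sv; rewrite vmul_vacl; case: ifP => // _; apply: subspace0.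
- move=> u v n hu hv m w Sw; apply: associator_closed => p q.
    by apply/hu/hv.
  by apply/hv/hu.
Qed.

End Closure.

Section Generated.
Variables (X : set V).

Lemma vertex_subalgebra_genP : is_vertex_subalgebra Y (vertex_subalgebra_gen Y X).
Proof.
split.
- apply/subspaceP; split=> [U [[hU _ _] _]|a u v hu hv U hU].
    exact: subspace0.
  have [[hs _ _] _] := hU.
  by apply: subspaceD => //; [apply: subspaceZ => //; apply: hu | apply: hv].
- by move=> U [[_ ? _] _].
- move=> u v n hu hv U hU; have [[_ _ hm] _] := hU.
  by apply: hm; [apply: hu | apply: hv].
Qed.

Lemma submodule_genP (U W : set V) :
  is_submodule Y U W W -> X `<=` W -> is_submodule Y U W (submodule_gen Y U W X).
Proof.
move=> hW XW; split.
- apply/subspaceP; split=> [N [[hN _ _] _]|a u v hu hv N hN].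
    exact: subspace0.
  have [[hs _ _] _] := hN.
  by apply: subspaceD => //; [apply: subspaceZ => //; apply: hu | apply: hv].
- by move=> v; apply.
- move=> u v n hu hv N hN; have [[_ _ hm] _] := hN.
  by apply: hm => //; apply: hv.
Qed.
End Generated.

End VertexAlgebra.

(** * Symplectic contractions and the swap operator *)

(** The index set carries an involution [rv] and signs [s] with s (rv i) = - s i: it
indexes a basis e_i of a symplectic space, e_(rv i) being dual to e_i up to
sign. *)
Section SymplecticBasis.
Variables (F : numFieldType) (I : finType) (rv : I -> I) (s : I -> F).
Hypotheses (rvK : involutive rv) (s_rv : forall i, s (rv i) = - s i).
Hypothesis s2 : forall i, s i * s i = 1.

Definition sympl (i j : I) : F := if i == rv j then s j else 0.

Lemma sympl_antisym i j : sympl i j = - sympl j i.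
Proof.
rewrite /sympl -(inj_eq (inv_inj rvK)) rvK eq_sym.
by case: eqP => [->|_]; rewrite ?s_rv // oppr0.
Qed.

Variable V : lmodType F.

(** The contraction of a bilinear expression with the inverse of the symplectic
form; contracting [sympl] itself gives the dimension, see [contract_sympl]. *)
Definition contract (g : I -> I -> V) : V := \sum_k - s k *: g k (rv k).

Lemma eq_contract g g' : (forall i j, g i j = g' i j) -> contract g = contract g'.
Proof. by move=> h; apply: eq_bigr => k _; rewrite h. Qed.

Lemma contractC g : contract (fun i j => g j i) = - contract g.
Proof.
rewrite /contract (reindex_inj (inv_inj rvK)) -sumrN.
by apply: eq_bigr => k _; rewrite rvK s_rv scaleNr.
Qed.

Lemma contractD g g' : contract (fun i j => g i j + g' i j) = contract g + contract g'.
Proof. by rewrite /contract -big_split; apply: eq_bigr => k _; rewrite scalerDr. Qed.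
Lemma contractZ a g : contract (fun i j => a *: g i j) = a *: contract g.
Proof.
by rewrite /contract scaler_sumr; apply: eq_bigr => k _; rewrite !scalerA mulrC.
Qed.
Lemma contractN g : contract (fun i j => - g i j) = - contract g.
Proof. by rewrite /contract -sumrN; apply: eq_bigr => k _; rewrite scalerN. Qed.

Lemma contract_sympl1l x (g : I -> V) : contract (fun i j => sympl i x *: g j) = g x.
Proof.
rewrite /contract (bigD1 (rv x)) //= big1 => [|k /negbTE kx]; last first.
  by rewrite /sympl kx scale0r scaler0.
by rewrite /sympl eqxx rvK scalerA s_rv opprK s2 scale1r addr0.
Qed.
Lemma contract_sympl1r x (g : I -> V) : contract (fun i j => sympl x i *: g j) = - g x.
Proof.
rewrite -[X in - X](contract_sympl1l x) -contractN.
by apply: eq_contract => i j; rewrite sympl_antisym scaleNr.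
Qed.
Lemma contract_sympl2l x (g : I -> V) : contract (fun i j => sympl j x *: g i) = - g x.
Proof. by rewrite (contractC (fun i j => sympl i x *: g j)) contract_sympl1l. Qed.
Lemma contract_sympl2r x (g : I -> V) : contract (fun i j => sympl x j *: g i) = g x.
Proof. by rewrite (contractC (fun i j => sympl x i *: g j)) contract_sympl1r opprK. Qed.
Lemma contract_sympl v : contract (fun i j => sympl i j *: v) = #|I|%:R *: v.
Proof.
rewrite /contract (eq_bigr (fun=> v)) => [|k _].
  by rewrite sumr_const scaler_nat.
by rewrite /sympl rvK eqxx scalerA s_rv mulrNN s2 scale1r.
Qed.
Lemma contract_closed S g : is_subspace S -> (forall i j, S (g i j)) -> S (contract g).
Proof. by move=> hS Sg; apply: subspace_sum => // k _; apply: subspaceZ. Qed.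

(** Here [f] stands for a tensor that is antisymmetric and traceless in its first two
and in its last two arguments, that is, for a vector in the tensor square of the
traceless part of the exterior square; everything is modulo [S].  The hypothesis
[rel] says that [f] has eigenvalue [x] for the mixed Casimir operator: in the
tensor square of the defining representation that operator is a combination of
the swap and the contraction, and [rel] sums it over the four pairs that consist
of one argument from each side. *)
Section SwapEigenvector.
Variables (S : set V) (hS : is_subspace S) (f : I -> I -> I -> I -> V) (x : F).
Hypotheses (f12 : forall a b c d, f b a c d = - f a b c d)
           (f34 : forall a b c d, f a b d c = - f a b c d)
           (tr12 : forall c d, contract (fun a b => f a b c d) = 0)
           (tr34 : forall a b, contract (fun c d => f a b c d) = 0).

Definition inner_contract a d : V := contract (fun b c => f a b c d).
Local Notation G := inner_contract.

Hypothesis rel : forall a b c d,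
  S (x *: f a b c d - (f c b a d + f a c b d + f d b c a + f a d c b)
     + sympl c a *: G b d - sympl c b *: G a d
     - sympl d a *: G b c + sympl d b *: G a c).
Hypotheses (x4 : x + 4 != 0) (x2 : x - 2 != 0)
           (xn : x + #|I|%:R != 0) (xn2 : x + #|I|%:R - 2 != 0)
           (x2n : x + 2 * #|I|%:R != 0).
Hypothesis pair_sym : x = 0 -> forall a b c d, S (f a b c d - f c d a b).

(** The contraction of [rel] in its second and third arguments. *)
Lemma inner_contract_rel a d :
  S ((x + #|I|%:R - 1) *: G a d - G d a + sympl a d *: contract G).
Proof.
have := contract_closed hS (fun b c => rel a b c d).
do ! rewrite ?(contractD, contractN, contractZ).
rewrite (contract_sympl2l a (G^~ d)) (contract_sympl1r d (G a)).
rewrite (contractC (fun b c => f b c a d)) (contractC (fun b c => f a b c d)).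
rewrite (contractC (fun b c => f a d b c)) tr12 tr34.
rewrite (contractC (fun b c => sympl b c *: G a d)) contract_sympl.
rewrite -!/(G _ _) (sympl_antisym a d).
by congr (S _); lmodule_ring.
Qed.

(** A second contraction gives (x + 2n) times the full contraction of [f], where n is
the dimension.  Then G, transposed, is x + n - 1 times G, and a transpose has
only the eigenvalues 1 and -1, which [xn2] and [xn] exclude. *)
Lemma inner_contract_closed a d : S (G a d).
Proof.
have H0 : S (contract G).
  apply: (subspace_scaleI hS x2n).
  have := contract_closed hS inner_contract_rel.
  do ! rewrite ?(contractD, contractN, contractZ).
  by rewrite (contractC G) contract_sympl; congr (S _); lmodule_ring.
have rG a' d' : S ((x + #|I|%:R - 1) *: G a' d' - G d' a').
  have := subspaceB hS (inner_contract_rel a' d') (subspaceZ hS (sympl a' d') H0).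
  by congr (S _); lmodule_ring.
apply: (subspace_scaleI hS (mulf_neq0 xn xn2)).
have := subspaceD hS (subspaceZ hS (x + #|I|%:R - 1) (rG a d)) (rG d a).
by congr (S _); lmodule_ring.
Qed.

(** Without contractions, [f] is an eigenvector of the sum of the four swaps across the
two pairs.  Its eigenvalues are 2, 0 and -4, on the tensors with the symmetry of
the Young diagrams (2,2), (2,1,1) and (1,1,1,1).  The first and the last are
excluded by hypothesis, and the middle one consists of the tensors that change
sign when the two pairs are exchanged. *)
Lemma swap_eigenvector_closed a b c d : S (f a b c d).
Proof.
have flip a' b' c' d' : f b' a' d' c' = f a' b' c' d' by rewrite f12 f34 opprK.
have rel' a' b' c' d' : S (x *: f a' b' c' d'
    - (f c' b' a' d' + f a' c' b' d' + f d' b' c' a' + f a' d' c' b')).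
  have := rel a' b' c' d'.
  move=> /(subspaceB hS)/(_ (subspaceZ hS (sympl c' a') (inner_contract_closed b' d'))).
  move=> /(subspaceD hS)/(_ (subspaceZ hS (sympl c' b') (inner_contract_closed a' d'))).
  move=> /(subspaceD hS)/(_ (subspaceZ hS (sympl d' a') (inner_contract_closed b' c'))).
  move=> /(subspaceB hS)/(_ (subspaceZ hS (sympl d' b') (inner_contract_closed a' c'))).
  by congr (S _); lmodule_ring.
(* Exchanging the pairs permutes the four swapped terms: the sum of swaps kills
   the part of f that is antisymmetric in the pairs. *)
have sym a' b' c' d' : S (f a' b' c' d' - f c' d' a' b').
  have [x0|x0] := eqVneq x 0; first exact: pair_sym.
  apply: (subspace_scaleI hS x0).
  have := subspaceB hS (rel' a' b' c' d') (rel' c' d' a' b').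
  by rewrite (flip a' c') (flip b' d'); congr (S _); lmodule_ring.
have rel2 a' b' c' d' :
    S (x *: f a' b' c' d' - (f a' c' b' d' - f a' d' b' c') *+ 2).
  have := subspaceD hS (rel' a' b' c' d')
            (subspaceD hS (sym c' b' a' d') (sym d' b' c' a')).
  rewrite (flip b' d') (f34 a' d') (f12 a' c' d' b') (f34 a' c' b' d').
  by congr (S _); lmodule_ring.
(* For a pair-symmetric f the orbit of f a b c d spans three vectors, one for each
   way to split the arguments into pairs; rel2 is a 3 by 3 linear system. *)
have r1 := rel2 a b c d.
have r3 := rel2 a c b d.
have r5 := rel2 a d b c.
rewrite (f34 a d b c) in r3; rewrite (f34 a b c d) (f34 a c b d) in r5.
have r0 : S (f a b c d - f a c b d + f a d b c).
  apply: (subspace_scaleI hS x4).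
  by have := subspaceD hS (subspaceB hS r1 r3) r5; congr (S _); lmodule_ring.
apply: (subspace_scaleI hS x2).
by have := subspaceB hS r1 (subspaceZ hS 2 r0); congr (S _); lmodule_ring.
Qed.
End SwapEigenvector.
End SymplecticBasis.

(** * Extension of a vertex algebra by the odd part of a symmetric pair *)

(** [JB0] says that the B transform under the J like an antisymmetric tensor.  The
factor #|I| in [TB] is twice the shifted level, and with it [TB] is the Sugawara
formula for the translation of the primary vectors B. *)
Section SymmetricPair.
Variables (F : numFieldType) (I : finType) (rv : I -> I) (s : I -> F).
Hypotheses (rvK : involutive rv) (s_rv : forall i, s (rv i) = - s i).
Hypothesis s2 : forall i, s i * s i = 1.
Hypothesis cardI : (2 < #|I|)%N.
Local Notation om := (sympl rv s).
Local Notation ctr := (contract rv s).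

Variables (V : lmodType F) (Y : vertex_algebra V) (J B : I -> I -> V).
Local Notation one := (vac Y).
Local Notation T v := (vmul Y v (-2) one).

Hypotheses
  (B_antisym : forall a b, B b a = - B a b)
  (B_tr : ctr B = 0)
  (JB0 : forall a b c d, vmul Y (J a b) 0 (B c d) =
     om b c *: B a d + om a c *: B b d + om b d *: B c a + om a d *: B c b)
  (JBn : forall a b c d (j : int), 0 < j -> vmul Y (J a b) j (B c d) = 0)
  (TB : forall c d,
     ctr (fun k k' => vmul Y (J c k) (-1) (B k' d) - vmul Y (J d k) (-1) (B k' c))
     = #|I|%:R *: T (B c d)).

Lemma odd_even_commutator a b c d (m n : int) v :
  vmul Y (B c d) m (vmul Y (J a b) n v) =
  vmul Y (J a b) n (vmul Y (B c d) m v)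
  - vmul Y (vmul Y (J a b) 0 (B c d)) (n + m) v.
Proof. by rewrite (commutator_primary _ _ _ (JBn a b c d)) addrK. Qed.

Section EvenProducts.
Variables (S : set V) (hS : is_vertex_subalgebra Y S).
Hypotheses (JS : forall a b, S (J a b))
  (BBge0 : forall a b c d (j : int), 0 <= j -> S (vmul Y (B a b) j (B c d))).

Let hS0 : is_subspace S. Proof. by case: hS. Qed.
Let vacS : S one. Proof. by case: hS. Qed.
Let vmulS u v n : S u -> S v -> S (vmul Y u n v).
Proof. by have [_ _ h] := hS; apply: h. Qed.

(** Applying the mode B_(m) to [TB] and commuting it with J_(-1) yields, up to terms
in [S], a multiple m of B_(m-1) B on one side and J_0 acting on the left factor
on the other: the eigenvector equation of the swap operator. *)
Lemma odd_odd_swap_relation a b c d (m : int)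
    (f := fun a b c d => vmul Y (B a b) (m - 1) (B c d))
    (G := inner_contract rv s f) :
  (forall a b c d, S (vmul Y (B a b) m (B c d))) ->
  S ((- m%:~R * #|I|%:R) *: f a b c d
     - (f c b a d + f a c b d + f d b c a + f a d c b)
     + om c a *: G b d - om c b *: G a d - om d a *: G b c + om d b *: G a c).
Proof.
move=> BBm.
have Gl a' d' : ctr (fun k k' => f k a' k' d') = - G a' d'.
  by rewrite -contractN; apply: eq_contract => k k'; rewrite /f B_antisym vmulNl.
have expand c' d' :
   ctr (fun k k' => vmul Y (B a b) m (vmul Y (J c' k) (-1) (B k' d')))
   = ctr (fun k k' => vmul Y (J c' k) (-1) (vmul Y (B a b) m (B k' d')))
     - (f c' b a d' - om c' a *: G b d' + f a c' b d' + om c' b *: G a d').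
  rewrite -(contract_sympl1l rvK s_rv s2 a (fun x => f c' b x d')).
  rewrite -(contract_sympl1l rvK s_rv s2 b (fun x => f a c' x d')).
  rewrite -[G a d']/(ctr _) -[- (_ *: _)]scalerN -Gl -!contractZ -!contractD.
  rewrite -contractN -contractD; apply: eq_contract => k k'.
  by rewrite odd_even_commutator JB0 !vmulDl !vmulZl (addrC (-1)).
have hT : S (#|I|%:R *: vmul Y (B a b) m (T (B c d))
   - ( - (f c b a d - om c a *: G b d + f a c b d + om c b *: G a d)
       + (f d b a c - om d a *: G b c + f a d b c + om d b *: G a c))).
  rewrite -vmulZr -TB vmul_sumr.
  have -> : \sum_k vmul Y (B a b) m (- s k *: (vmul Y (J c k) (-1) (B (rv k) d) -
      vmul Y (J d k) (-1) (B (rv k) c))) =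
    ctr (fun k k' => vmul Y (B a b) m (vmul Y (J c k) (-1) (B k' d))) -
    ctr (fun k k' => vmul Y (B a b) m (vmul Y (J d k) (-1) (B k' c))).
    rewrite -contractN -contractD; apply: eq_bigr => k _.
    by rewrite vmulZr vmulDr vmulNr.
  rewrite !expand.
  have h c' d' :
      S (ctr (fun k k' => vmul Y (J c' k) (-1) (vmul Y (B a b) m (B k' d')))).
    by apply: contract_closed => // k k'; apply: vmulS.
  by have := subspaceB hS0 (h c d) (h d c); congr (S _); lmodule_ring.
have hTf : S (T (vmul Y (B a b) m (B c d))) by apply: vmulS.
have e1 : f d b a c = - f d b c a by rewrite /f (B_antisym c a) vmulNr.
have e2 : f a d b c = - f a d c b by rewrite /f (B_antisym c b) vmulNr.
rewrite e1 e2 in hT.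
have := subspaceB hS0 (subspaceZ hS0 #|I|%:R hTf) hT.
by rewrite translation -/(f a b c d); congr (S _); lmodule_ring.
Qed.

(** By descending induction on the index; the step from m = - k to m - 1 has the
eigenvalue x = k n of the swap operator, where n >= 3 is the dimension, and such
an x is neither 2 nor negative, nor is x + n - 2 zero. *)
Lemma odd_odd_closed a b c d (n : int) : S (vmul Y (B a b) n (B c d)).
Proof.
have [n0|n0] := leP 0 n; first exact: BBge0.
have -> : n = - `|n|%N%:Z by lia.
elim: `|n|%N a b c d => {n n0} [|k IH] a b c d; first exact: BBge0.
have -> : - k.+1%:Z = - k%:Z - 1 by lia.
set f := fun a b c d => vmul Y (B a b) (- k%:Z - 1) (B c d).
have xE : - (- k%:Z)%:~R * #|I|%:R = (k * #|I|)%:R :> F.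
  by rewrite natrM mulrNz opprK.
have f12 a' b' c' d' : f b' a' c' d' = - f a' b' c' d'.
  by rewrite /f B_antisym vmulNl.
have f34 a' b' c' d' : f a' b' d' c' = - f a' b' c' d'.
  by rewrite /f (B_antisym c' d') vmulNr.
have tr12 c' d' : ctr (fun a b => f a b c' d') = 0.
  rewrite -[RHS](vmul0l Y (- k%:Z - 1) (B c' d')) -B_tr vmul_suml.
  by apply: eq_bigr => i _; rewrite vmulZl.
have tr34 a' b' : ctr (f a' b') = 0.
  rewrite -[RHS](vmul0r Y (B a' b') (- k%:Z - 1)) -B_tr vmul_sumr.
  by apply: eq_bigr => i _; rewrite vmulZr.
have rel a' b' c' d' := odd_odd_swap_relation a' b' c' d' IH.
apply: (swap_eigenvector_closed rvK s_rv s2 hS0 f12 f34 tr12 tr34 rel).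
- by rewrite xE -natrD pnatr_eq0 addn_eq0 andbF.
- by rewrite xE subr_eq0 eqr_nat; apply/eqP; move: cardI; case: (k) => [|k']; nia.
- by rewrite xE -natrD pnatr_eq0 -lt0n; lia.
- by rewrite xE -natrD subr_eq0 eqr_nat; lia.
- by rewrite xE -natrM -natrD pnatr_eq0 -lt0n; lia.
move=> /eqP; rewrite xE pnatr_eq0 muln_eq0 => /orP[/eqP k0|/eqP]; last by lia.
move=> a' b' c' d'.
(* k = 0: on the vacuum, exchanging the factors of the product of index -1 is a
   commutator, whose terms have products of nonnegative index. *)
have [K hK] := vmul_trunc_nat Y (B a' b') (B c' d') 0.
rewrite /f k0 oppr0 sub0r -[X in vmul Y _ _ X - _](vmul_vacrN1 Y).
rewrite -[X in _ - vmul Y _ _ X](vmul_vacrN1 Y) (@commutator _ _ _ _ _ _ _ _ K).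
  apply: subspace_sum => // j _; apply: subspaceZ => //.
  by apply: vmulS => //; apply: BBge0.
by move=> j /hK; rewrite add0r.
Qed.
End EvenProducts.

Section Generation.
Variables (N : set V) (hN : is_subspace N).
Hypothesis JN : forall a b v, N v -> N (vmul Y (J a b) 0 v).

Let two_neq0 : 2%:R != 0 :> F. Proof. by rewrite pnatr_eq0. Qed.

Lemma sign_neq0 i : s i != 0.
Proof.
by apply/eqP => s0; have := s2 i; rewrite s0 mul0r => /esym/eqP; rewrite oner_eq0.
Qed.

Lemma sympl_neq0 i j : i != rv j -> om i j = 0.
Proof. by rewrite /sympl => /negbTE->. Qed.
Lemma sympl_rvl i : om (rv i) i = s i.
Proof. by rewrite /sympl eqxx. Qed.

Lemma half_signD i : s i / 2 * (s i + s i) = 1.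
Proof. by rewrite -[RHS](s2 i); field. Qed.

(** The span of the B is an irreducible representation of sp.  Raising operators
J(a, rv i) replace an index i by a.  The zero weight vectors B(i, rv i) are only
reached as differences, and trace zero then gives each of them. *)
Lemma odd_generated i1 i2 : i2 != i1 -> i2 != rv i1 -> N (B i1 i2) ->
  forall a b, N (B a b).
Proof.
move=> i21 i21' N12.
have rv_eq i j : (rv i == j) = (i == rv j) by rewrite -(inj_eq (inv_inj rvK)) rvK.
have Na2 a : a != rv i2 -> N (B a i2).
  move=> a2; have [->//|a1] := eqVneq a i1.
  have [->|a1'] := eqVneq a (rv i1).
    have := JN (rv i1) (rv i1) N12; rewrite JB0 sympl_rvl.
    rewrite (@sympl_neq0 (rv i1) i2) ?rv_eq ?rvK 1?eq_sym //.
    move=> /(subspaceZ hN (s i1 / 2)); rewrite !scale0r !addr0 -scalerDl scalerA.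
    by rewrite half_signD scale1r.
  have := JN a (rv i1) N12; rewrite JB0 sympl_rvl (sympl_neq0 a1') (sympl_neq0 a2).
  rewrite (@sympl_neq0 (rv i1) i2) ?rv_eq ?rvK 1?eq_sym //.
  by move=> /(subspaceZ hN (s i1)); rewrite !scale0r !addr0 scalerA s2 scale1r.
have Bdiag a : B a a = 0.
  apply: (scalerI two_neq0); rewrite scaler0 scaler_nat mulr2n.
  by rewrite [X in X + _]B_antisym addNr.
have Nab a b : a != i2 -> a != rv i2 -> b != rv a -> N (B a b).
  move=> a2 a2' ba; have := JN b (rv i2) (Na2 a a2').
  rewrite JB0 sympl_rvl (sympl_neq0 ba) (@sympl_neq0 (rv i2) a) ?rv_eq ?rvK 1?eq_sym //.
  have [->|b2] := eqVneq b (rv i2).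
    rewrite sympl_rvl => /(subspaceZ hN (s i2 / 2)).
    rewrite !scale0r !add0r -scalerDl scalerA.
    by rewrite half_signD scale1r.
  rewrite (sympl_neq0 b2) => /(subspaceZ hN (s i2)).
  by rewrite !scale0r addr0 !add0r scalerA s2 scale1r.
have Nneq a b : b != rv a -> N (B a b).
  move=> ba; have [a2|a2] := eqVneq a i2.
    rewrite B_antisym; apply: subspaceN => //; rewrite a2 in ba *.
    exact: Na2.
  have [a2'|a2'] := eqVneq a (rv i2); last exact: Nab.
  have [->|nab] := eqVneq a b; first by rewrite Bdiag; apply: subspace0.
  rewrite B_antisym; apply: subspaceN => //; rewrite a2' in ba nab *.
  rewrite rvK in ba; apply: Nab => //; first by rewrite eq_sym.
  by rewrite (inj_eq (inv_inj rvK)) eq_sym.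
(* J(rv i, rv j) sends B(i, j) to a difference of two zero weight vectors. *)
have Ndiff i j : N (s i *: B i (rv i) - s j *: B j (rv j)).
  have [->|ij] := eqVneq i j; first by rewrite subrr; apply: subspace0.
  have [->|ij'] := eqVneq i (rv j).
    rewrite s_rv rvK B_antisym scaleNr scalerN opprK subrr; exact: subspace0.
  have ji' : j != rv i by rewrite eq_sym rv_eq.
  have := JN (rv i) (rv j) (Nneq _ _ ji'); rewrite JB0 !sympl_rvl.
  rewrite (@sympl_neq0 (rv j) i) ?(@sympl_neq0 (rv i) j) ?(inj_eq (inv_inj rvK)) //;
    last by rewrite eq_sym.
  rewrite (B_antisym j (rv j)) => /(subspaceZ hN (s i * s j)); congr (N _).
  transitivity ((s j * s j) *: (s i *: B i (rv i))
                - (s i * s i) *: (s j *: B j (rv j))).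
    by lmodule_ring.
  by rewrite !s2 !scale1r.
move=> a b; have [->|] := eqVneq b (rv a); last exact: Nneq.
have := subspace_sum hN (index_enum I) (fun j (_ : true) => Ndiff a j).
rewrite sumrB sumr_const -scaler_nat scalerA.
have -> : \sum_i s i *: B i (rv i) = 0.
  rewrite -[RHS]oppr0 -[X in - X]B_tr -contractN; apply: eq_bigr => i _.
  by rewrite scaleNr scalerN opprK.
rewrite subr0; apply: subspace_scaleI => //.
by rewrite mulf_neq0 ?sign_neq0 // pnatr_eq0 -lt0n; apply: leq_trans cardI.
Qed.
End Generation.

(** [S] is the even part, [N] the odd part and [W] an ambient vertex algebra. *)
Section Extension.
Variables (S W : set V) (i1 i2 : I) (a : F) (e : V).
Hypotheses (hS : S = vertex_subalgebra_gen Y [set v | exists i j, v = J i j])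
  (hW : is_vertex_subalgebra Y W) (SW : S `<=` W) (We : W e)
  (a0 : a != 0) (eB : e = a *: B i1 i2) (i21 : i2 != i1) (i21' : i2 != rv i1).
Hypothesis BBge0 :
  forall a b c d (j : int), 0 <= j -> S (vmul Y (B a b) j (B c d)).

Local Notation N := (submodule_gen Y S W [set e]).

Let hSA : is_vertex_subalgebra Y S.
Proof. by rewrite hS; apply: vertex_subalgebra_genP. Qed.
Let hS0 : is_subspace S. Proof. by case: hSA. Qed.
Let vacS : S one. Proof. by case: hSA. Qed.
Let vmulS u v n : S u -> S v -> S (vmul Y u n v).
Proof. by have [_ _ h] := hSA; apply: h. Qed.
Let JS i j : S (J i j).
Proof. by rewrite hS => U [_ /(_ (J i j))]; apply; exists i, j. Qed.

Let hN : is_submodule Y S W N.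
Proof.
have [hW0 _ vmulW] := hW.
apply: submodule_genP => [|_ ->//]; split=> // u v n /SW Wu; exact: vmulW.
Qed.
Let hN0 : is_subspace N. Proof. by case: hN. Qed.
Let NW : N `<=` W. Proof. by case: hN. Qed.
Let vmulN u v n : S u -> N v -> N (vmul Y u n v).
Proof. by have [_ _ h] := hN; apply: h. Qed.
Let Ne : N e. Proof. by move=> P [_]; apply. Qed.

Lemma even_stable (P : set V) : is_subspace P ->
  (forall i j n v, P v -> P (vmul Y (J i j) n v)) ->
  forall u n v, S u -> P v -> P (vmul Y u n v).
Proof.
move=> hP JP u n v; rewrite hS => /(_ [set u | forall n v, P v -> P (vmul Y u n v)]).
move=> h; apply: h; split; first exact: stabilizer_subalgebra.
by move=> _ [i [j ->]] m w; apply: JP.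
Qed.

(** The submodules in the definition of [N] lie in [W]; the intersection of [P] and
[N] is one of them. *)
Lemma odd_ind (P : set V) : is_subspace P -> P e ->
  (forall u n v, S u -> P v -> P (vmul Y u n v)) -> N `<=` P.
Proof.
move=> hP Pe SP; suff : N `<=` P `&` N by move=> h v /h[].
move=> v; apply; split; last by move=> _ ->.
split.
- apply/subspaceP; split=> [|b u w [Pu Nu] [Pw Nw]].
    by split; apply: subspace0.
  split; first exact: (subspaceD hP (subspaceZ hP b Pu)).
  exact: (subspaceD hN0 (subspaceZ hN0 b Nu)).
- by move=> w [_ /NW].
- by move=> u w n Su [Pw Nw]; split; [apply: SP | apply: vmulN].
Qed.

Lemma odd_submodule_gens i j : N (B i j).
Proof.
apply: (odd_generated hN0) => [b c v|||]; [exact: vmulN|exact: i21|exact: i21'|].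
by apply: (subspace_scaleI hN0 a0); rewrite -eB.
Qed.

Lemma odd_translation v : N v -> N (T v).
Proof.
have hNT : is_subspace [set v | N v /\ N (T v)].
  apply/subspaceP; split=> [|b u w [Nu Tu] [Nw Tw]].
    by rewrite /= vmul0l; split; apply: subspace0.
  rewrite /= vmulDl vmulZl.
  split; first exact: (subspaceD hN0 (subspaceZ hN0 b Nu)).
  exact: (subspaceD hN0 (subspaceZ hN0 b Tu)).
suff : N `<=` [set v | N v /\ N (T v)] by move=> h /h[].
apply: odd_ind => // [|u n w Su [Nw Tw]]; last first.
  split; first exact: vmulN.
  rewrite translation; apply: (subspaceB hN0); first exact: vmulN.
  by apply: (subspaceZ hN0); apply: vmulN.
split; first exact: Ne.
have -> : T e = a *: T (B i1 i2) by rewrite eB vmulZl.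
apply: (subspaceZ hN0).
apply: (@subspace_scaleI _ _ _ hN0 #|I|%:R).
  by rewrite pnatr_eq0 -lt0n; lia.
rewrite -TB; apply: (contract_closed _ _ hN0) => k k'.
by apply: (subspaceB hN0); apply: vmulN => //; apply: odd_submodule_gens.
Qed.

(** The vectors v_(-k-1) 1 are T^k v / k!. *)
Lemma odd_creation v n : N v -> N (vmul Y v n one).
Proof.
move=> Nv; have [n0|n0] := leP 0 n.
  by rewrite vmul_vacr_ge0 //; apply: (subspace0 hN0).
have -> : n = - `|n|.-1.+1%N%:Z by lia.
elim: `|n|.-1 => {n n0} [|k IH]; first by rewrite vmul_vacrN1.
have := odd_translation IH.
rewrite translation translation_vac vmul0r sub0r -scaleNr.
have -> : - k.+1%:Z - 1 = - k.+2%:Z by lia.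
by apply: (subspace_scaleI hN0); rewrite mulrNz opprK pnatr_eq0.
Qed.

(** Moving B past J leaves a mode of another B, as sp stabilizes the span of the B. *)
Lemma even_mode_stable (P Q : set V) : is_subspace Q ->
  (forall i j n v, Q v -> Q (vmul Y (J i j) n v)) ->
  (forall i j n v, P v -> Q (vmul Y (B i j) n v)) ->
  forall b c m i j n v, P v -> Q (vmul Y (B i j) n (vmul Y (J b c) m v)).
Proof.
move=> hQ JQ BQ b c m i j n v Pv.
rewrite odd_even_commutator; apply: (subspaceB hQ); first by apply/JQ/BQ.
rewrite JB0 !vmulDl !vmulZl.
by do ! apply: (subspaceD hQ); apply: (subspaceZ hQ); apply: BQ.
Qed.

Lemma odd_mul_even i j n v : S v -> N (vmul Y (B i j) n v).
Proof.
pose P := [set v | forall i j n, N (vmul Y (B i j) n v)].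
have hP : is_subspace P.
  apply/subspaceP; split=> [b c m|x u w Pu Pw b c m].
    by rewrite vmul0r; apply: (subspace0 hN0).
  rewrite vmulDr vmulZr.
  exact: (subspaceD hN0 (subspaceZ hN0 x (Pu b c m)) (Pw b c m)).
have JP b c m w : P w -> P (vmul Y (J b c) m w).
  move=> Pw i' j' n'; apply: (@even_mode_stable P N hN0) => [b2 c2 m2 x||//].
    by apply: vmulN.
  by move=> ? ? ? x; apply.
move=> Sv; rewrite -[v](vmul_vacrN1 Y).
apply: (even_stable hP JP (-1) Sv) => b c m.
exact: (odd_creation m (odd_submodule_gens b c)).
Qed.

Lemma odd_mul_odd i j n v : N v -> S (vmul Y (B i j) n v).
Proof.
pose P := [set v | forall i j n, S (vmul Y (B i j) n v)].
have hP : is_subspace P.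
  apply/subspaceP; split=> [b c m|x u w Pu Pw b c m].
    by rewrite vmul0r; apply: (subspace0 hS0).
  rewrite vmulDr vmulZr.
  exact: (subspaceD hS0 (subspaceZ hS0 x (Pu b c m)) (Pw b c m)).
have JP b c m w : P w -> P (vmul Y (J b c) m w).
  move=> Pw i' j' n'; apply: (@even_mode_stable P S hS0) => [b2 c2 m2 x||//].
    by apply: vmulS.
  by move=> ? ? ? x; apply.
suff : N `<=` P by move=> h /h; apply.
apply: (odd_ind hP) => [b c m|u m w Su Pw].
  rewrite eB vmulZr; apply: (subspaceZ hS0).
  exact: (odd_odd_closed hSA JS BBge0).
exact: (even_stable hP JP m Su Pw).
Qed.

(** The products of generators extend to all of [N] by associativity. *)
Lemma odd_products u n : N u ->
  (forall v, S v -> N (vmul Y u n v)) /\ (forall v, N v -> S (vmul Y u n v)).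
Proof.
pose P := [set u | forall n, (forall v, S v -> N (vmul Y u n v)) /\
                             (forall v, N v -> S (vmul Y u n v))].
suff : N `<=` P by move=> h /h/(_ n).
apply: odd_ind.
- apply/subspaceP; split=> [m|x w w' Pw Pw' m]; split=> v hv.
  + by rewrite vmul0l; apply: (subspace0 hN0).
  + by rewrite vmul0l; apply: (subspace0 hS0).
  + have [[h _] [h' _]] := (Pw m, Pw' m); rewrite vmulDl vmulZl.
    exact: (subspaceD hN0 (subspaceZ hN0 x (h v hv)) (h' v hv)).
  + have [[_ h] [_ h']] := (Pw m, Pw' m); rewrite vmulDl vmulZl.
    exact: (subspaceD hS0 (subspaceZ hS0 x (h v hv)) (h' v hv)).
- move=> m; split=> v hv;
    have -> : vmul Y e m v = a *: vmul Y (B i1 i2) m v by rewrite eB vmulZl.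
    by apply: (subspaceZ hN0); apply: odd_mul_even.
  by apply: (subspaceZ hS0); apply: odd_mul_odd.
- move=> x l w Sx Pw m; split=> v hv; apply: associator_closed => // p q.
  + by have [h _] := Pw q; apply: vmulN => //; apply: h.
  + by have [h _] := Pw p; apply: h; apply: vmulS.
  + by have [_ h] := Pw q; apply: vmulS => //; apply: h.
  + by have [_ h] := Pw p; apply: h; apply: vmulN.
Qed.

Lemma extension_subalgebra : is_vertex_subalgebra Y [set u + v | u in S & v in N].
Proof.
split.
- apply/subspaceP; split=> [|x _ _ [u Su [v Nv <-]] [u' Su' [v' Nv' <-]]].
    exists 0; first exact: (subspace0 hS0).
    by exists 0; [exact: (subspace0 hN0) | rewrite addr0].
  exists (x *: u + u'); first exact: (subspaceD hS0 (subspaceZ hS0 x Su) Su').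
  exists (x *: v + v'); first exact: (subspaceD hN0 (subspaceZ hN0 x Nv) Nv').
  by rewrite scalerDr addrACA.
- by exists one => //; exists 0; [exact: (subspace0 hN0)|rewrite addr0].
- move=> _ _ n [u Su [v Nv <-]] [u' Su' [v' Nv' <-]].
  exists (vmul Y u n u' + vmul Y v n v').
    apply: (subspaceD hS0); first exact: vmulS.
    by have [_ h] := odd_products n Nv; apply: h.
  exists (vmul Y u n v' + vmul Y v n u').
    apply: (subspaceD hN0); first exact: vmulN.
    by have [h _] := odd_products n Nv; apply: h.
  by rewrite !vmulDl !vmulDr; lmodule_ring.
Qed.

End Extension.

End SymmetricPair.

(** * Quadratic expressions in free bosons *)

(** The vectors [h x] have conformal weight 1/2, which is why all products of index
at least 1 among them vanish. *)
Section FreeBosons.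
Variables (F : numFieldType) (V : lmodType F) (Y : vertex_algebra V).
Local Notation one := (vac Y).
Local Notation T v := (vmul Y v (-2) one).
Variables (X : Type) (h : X -> V) (g : X -> X -> F).
Hypothesis h_comm : forall x y (m n : int) v,
  vmul Y (h x) m (vmul Y (h y) n v) =
  vmul Y (h y) n (vmul Y (h x) m v) + (if m + n + 1 == 0 then g x y else 0) *: v.

Definition quad x y := vmul Y (h x) (-1) (h y).

Lemma boson_boson x y (n : int) : 0 <= n ->
  vmul Y (h x) n (h y) = (if n == 0 then g x y else 0) *: one.
Proof.
move=> n0; rewrite -[h y](vmul_vacrN1 Y) h_comm vmul_vacr_ge0 // vmul0r add0r.
by congr (_ *: _); rewrite addrNK.
Qed.

Lemma boson_boson0 x y : vmul Y (h x) 0 (h y) = g x y *: one.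
Proof. by rewrite boson_boson ?eqxx. Qed.

Lemma boson_boson_gt0 x y (n : int) : 0 < n -> vmul Y (h x) n (h y) = 0.
Proof.
move=> n0; rewrite boson_boson ?ltW // (negbTE (lt0r_neq0 n0)) scale0r //.
Qed.

Lemma quadC x y : quad x y = quad y x.
Proof.
rewrite /quad -[h y in LHS](vmul_vacrN1 Y) h_comm vmul_vacrN1.
by rewrite (_ : -1 - 1 + 1 == 0 = false) // scale0r addr0.
Qed.

Lemma quad_boson0 a b c :
  vmul Y (quad a b) 0 (h c) = g b c *: h a + g a c *: h b.
Proof.
have [K0 hK] := normal_order_large Y (h a) (h b) (h c) 0.
rewrite /quad (hK K0.+1) // big_ord_recl big1 => [|j _]; last first.
  by rewrite !boson_boson_gt0 ?vmul0r ?addr0 //= /bump; lia.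
by rewrite !(addr0, subr0, sub0r) !boson_boson0 !vmulZr !vmul_vacrN1.
Qed.

Lemma quad_boson_gt0 a b c (n : int) : 0 < n -> vmul Y (quad a b) n (h c) = 0.
Proof.
move=> n0; have [K0 hK] := normal_order_large Y (h a) (h b) (h c) n.
rewrite /quad (hK K0.+1) // big_ord_recl big1 => [|j _]; last first.
  by rewrite !boson_boson_gt0 ?vmul0r ?addr0 //= /bump; lia.
rewrite !(addr0, subr0, sub0r) boson_boson_gt0 // vmul0r add0r boson_boson0.
by rewrite vmulZr vmul_vacr_ge0 ?scaler0 //; lia.
Qed.

Lemma quad_bosonN1 a b c : vmul Y (quad a b) (-1) (h c) =
  vmul Y (h a) (-1) (quad b c) + g b c *: T (h a) + g a c *: T (h b).
Proof.
have [K0 hK] := normal_order_large Y (h a) (h b) (h c) (-1).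
rewrite [X in vmul Y X]/quad (hK K0.+2) //; last by lia.
rewrite !big_ord_recl big1 => [|j _]; last first.
  by rewrite !boson_boson_gt0 ?vmul0r ?addr0 //= /bump; lia.
rewrite (_ : (ord0 : nat)%:Z = 0) // (_ : (lift ord0 ord0 : nat)%:Z = 1) //.
rewrite !(addr0, subr0) addNr boson_boson0 boson_boson0 (boson_boson_gt0 a) //.
by rewrite vmul0r addr0 !vmulZr addrAC.
Qed.

Lemma quad_boson_comm a b c (m n : int) v :
  vmul Y (quad a b) m (vmul Y (h c) n v) =
  vmul Y (h c) n (vmul Y (quad a b) m v)
  + vmul Y (vmul Y (quad a b) 0 (h c)) (m + n) v.
Proof. by apply: commutator_primary => j; apply: quad_boson_gt0. Qed.

Lemma quad_quad1 a b c d : vmul Y (quad a b) 1 (quad c d) =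
  (g b c * g a d + g a c * g b d) *: one.
Proof.
rewrite quad_boson_comm quad_boson_gt0 // vmul0r add0r quad_boson0 subrr.
by rewrite !vmulDl !vmulZl !boson_boson0 scalerDl !scalerA.
Qed.

Lemma quad_quad_gt1 a b c d (n : int) : 1 < n ->
  vmul Y (quad a b) n (quad c d) = 0.
Proof.
move=> n1; rewrite quad_boson_comm quad_boson_gt0 ?(lt_trans _ n1) // vmul0r add0r.
rewrite quad_boson0 !vmulDl !vmulZl !boson_boson_gt0 ?subr_gt0 //.
by rewrite !scaler0 addr0.
Qed.

Lemma quad_quadN1 a b c d : vmul Y (quad a b) (-1) (quad c d) =
  vmul Y (h c) (-1) (vmul Y (h a) (-1) (quad b d))
  + g b d *: vmul Y (h c) (-1) (T (h a)) + g a d *: vmul Y (h c) (-1) (T (h b))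
  + g b c *: vmul Y (h a) (-2) (h d) + g a c *: vmul Y (h b) (-2) (h d).
Proof.
rewrite quad_boson_comm quad_bosonN1 !vmulDr !vmulZr quad_boson0 !vmulDl !vmulZl.
by rewrite !addrA.
Qed.

Lemma translation_quad a b :
  T (quad a b) = vmul Y (h a) (-1) (T (h b)) + vmul Y (h a) (-2) (h b).
Proof. by rewrite translation mulrN1z scaleN1r opprK. Qed.

Lemma bosonN1C x y v :
  vmul Y (h x) (-1) (vmul Y (h y) (-1) v) = vmul Y (h y) (-1) (vmul Y (h x) (-1) v).
Proof. by rewrite h_comm (_ : -1 - 1 + 1 == 0 = false) // scale0r addr0. Qed.

End FreeBosons.

(** * The currents of gl at level -1 *)

(** Two families of bosons psi_i = h (true, i) and psi*_i = h (false, i), each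
spanning the symplectic space and paired with the other by the symplectic form.
With both families indexed this way, sp acts on them by the same formulas. *)
Section SymplecticBosons.
Variables (F : numFieldType) (I : finType) (rv : I -> I) (s : I -> F).
Hypotheses (rvK : involutive rv) (s_rv : forall i, s (rv i) = - s i).
Hypothesis s2 : forall i, s i * s i = 1.
Local Notation om := (sympl rv s).
Local Notation ctr := (contract rv s).

Variables (V : lmodType F) (Y : vertex_algebra V).
Local Notation one := (vac Y).
Local Notation T v := (vmul Y v (-2) one).
Variable h : bool * I -> V.
Definition boson_pairing (x y : bool * I) : F := if x.1 == y.1 then 0 else om x.2 y.2.
Hypothesis h_comm : forall x y (m n : int) v,
  vmul Y (h x) m (vmul Y (h y) n v) =
  vmul Y (h y) n (vmul Y (h x) m v)
  + (if m + n + 1 == 0 then boson_pairing x y else 0) *: v.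

Local Notation Q := (quad Y h).
Definition gl_current i j := Q (true, i) (false, j).
Local Notation E := gl_current.
Definition sp_current i j := E i j + E j i.
Local Notation J := sp_current.
Definition skew_current i j := E i j - E j i.
Local Notation A := skew_current.
Definition trace_current := ctr E.
Local Notation alpha := trace_current.
(** The coefficient makes the contraction vanish, see [odd_traceless]. *)
Definition odd_current i j := A i j - (2 / #|I|%:R * om i j) *: alpha.
Local Notation B := odd_current.

Let bh := quad_boson0 h_comm.

Lemma sp_boson0 a b x c :
  vmul Y (J a b) 0 (h (x, c)) = om b c *: h (x, a) + om a c *: h (x, b).
Proof.
rewrite vmulDl !bh /boson_pairing /=; case: x => /=; lmodule_ring.
Qed.

Lemma sp_quad0 a b x c y d : vmul Y (J a b) 0 (Q (x, c) (y, d)) =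
  om b c *: Q (x, a) (y, d) + om a c *: Q (x, b) (y, d)
  + om b d *: Q (x, c) (y, a) + om a d *: Q (x, c) (y, b).
Proof.
rewrite vmul0_derivation !sp_boson0 !vmulDl !vmulZl vmulDr !vmulZr.
by rewrite !addrA.
Qed.

Lemma sp_skew0 a b c d : vmul Y (J a b) 0 (A c d) =
  om b c *: A a d + om a c *: A b d + om b d *: A c a + om a d *: A c b.
Proof. rewrite vmulDr vmulNr !sp_quad0 -!/(E _ _) /skew_current; lmodule_ring. Qed.

Lemma vmul_contract u n f : vmul Y u n (ctr f) = ctr (fun i j => vmul Y u n (f i j)).
Proof. by rewrite vmul_sumr; apply: eq_bigr => k _; rewrite vmulZr. Qed.
Lemma contract_vmul n f v : vmul Y (ctr f) n v = ctr (fun i j => vmul Y (f i j) n v).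
Proof. by rewrite vmul_suml; apply: eq_bigr => k _; rewrite vmulZl. Qed.

Lemma sp_trace0 a b : vmul Y (J a b) 0 alpha = 0.
Proof.
rewrite vmul_contract (eq_contract _ _ (sp_quad0 a b true ^~ false)) !contractD.
rewrite (contract_sympl1r _ _ _ b (fun j => E a j)) //.
rewrite (contract_sympl1r _ _ _ a (fun j => E b j)) //.
rewrite (contract_sympl2r _ _ _ b (fun i => E i a)) //.
rewrite (contract_sympl2r _ _ _ a (fun i => E i b)) //.
by lmodule_ring.
Qed.

Lemma sp_odd0 a b c d : vmul Y (J a b) 0 (B c d) =
  om b c *: B a d + om a c *: B b d + om b d *: B c a + om a d *: B c b.
Proof.
rewrite vmulDr vmulNr vmulZr sp_trace0 sp_skew0 /odd_current !(sympl_antisym rvK s_rv c).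
by rewrite (sympl_antisym rvK s_rv b d) (sympl_antisym rvK s_rv a d); lmodule_ring.
Qed.

Lemma vmul_odd u n c d : vmul Y u n (B c d) =
  vmul Y u n (E c d) - vmul Y u n (E d c)
  - (2 / #|I|%:R * om c d) *: ctr (fun k k' => vmul Y u n (E k k')).
Proof. by rewrite !(vmulDr, vmulNr) vmulZr vmul_contract. Qed.

Lemma odd_vmul n a b v : vmul Y (B a b) n v =
  vmul Y (E a b) n v - vmul Y (E b a) n v
  - (2 / #|I|%:R * om a b) *: ctr (fun k k' => vmul Y (E k k') n v).
Proof. by rewrite !(vmulDl, vmulNl) vmulZl contract_vmul. Qed.

Lemma sp_gl1 a b c d :
  vmul Y (J a b) 1 (E c d) = (om b c * om a d + om a c * om b d) *: one.
Proof. by rewrite vmulDl !(quad_quad1 h_comm) /boson_pairing /=; lmodule_ring. Qed.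

Lemma sp_odd_gt0 a b c d (j : int) : 0 < j -> vmul Y (J a b) j (B c d) = 0.
Proof.
have [->|j1] := eqVneq j 1 => j0; last first.
  have E0 k k' : vmul Y (J a b) j (E k k') = 0.
    by rewrite vmulDl !(quad_quad_gt1 h_comm) ?addr0 //; lia.
  rewrite vmul_odd !E0 [ctr _]big1 => [|k _]; last by rewrite E0 scaler0.
  by rewrite scaler0 !subr0.
rewrite vmul_odd !sp_gl1 (eq_contract _ _ (sp_gl1 a b)).
rewrite (eq_contract _ _ (fun k k' => scalerDl one (om b k * om a k') _)) contractD.
rewrite (eq_contract _ _ (fun k k' => esym (scalerA (om b k) (om a k') one))).
rewrite (eq_contract _ _ (fun k k' => esym (scalerA (om a k) (om b k') one))).
rewrite (contract_sympl1r rvK s_rv s2 b (fun k' => om a k' *: one)).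
rewrite (contract_sympl1r rvK s_rv s2 a (fun k' => om b k' *: one)).
by rewrite (sympl_antisym rvK s_rv b a); lmodule_ring.
Qed.

Lemma skew_boson0 a b x c : vmul Y (A a b) 0 (h (x, c)) =
  (-1) ^+ x *: (om a c *: h (x, b) - om b c *: h (x, a)).
Proof.
by rewrite vmulDl vmulNl !bh /boson_pairing /=; case: x => /=; lmodule_ring.
Qed.

(** The zero mode of the trace current measures the charge: -1 on psi, 1 on psi*.
Hence it kills the neutral vectors psi psi*. *)
Lemma trace_boson0 x c : vmul Y alpha 0 (h (x, c)) = (-1) ^+ x *: h (x, c).
Proof.
rewrite contract_vmul; case: x.
  rewrite (eq_contract _ _ (g' := fun k k' => om k' c *: h (true, k))) => [|k k'].
    by rewrite (contract_sympl2l _ _ _ c (fun k => h (true, k))) //; lmodule_ring.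
  by rewrite bh /boson_pairing /=; lmodule_ring.
rewrite (eq_contract _ _ (g' := fun k k' => om k c *: h (false, k'))) => [|k k'].
  by rewrite (contract_sympl1l _ _ _ c (fun k => h (false, k))) //; lmodule_ring.
by rewrite bh /boson_pairing /=; lmodule_ring.
Qed.

Lemma trace_gl0 a b : vmul Y alpha 0 (E a b) = 0.
Proof.
by rewrite vmul0_derivation !trace_boson0 vmulZl vmulZr; lmodule_ring.
Qed.

Lemma skew_gl0 a b c d : vmul Y (A a b) 0 (E c d) =
  om b c *: E a d - om a c *: E b d - om b d *: E c a + om a d *: E c b.
Proof.
rewrite vmul0_derivation !skew_boson0.
rewrite !(vmulZl, vmulZr, vmulDl, vmulDr, vmulNl, vmulNr) -!/(Q _ _) -!/(E _ _).
by lmodule_ring.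
Qed.

Lemma skew_trace0 a b : vmul Y (A a b) 0 alpha = 0.
Proof.
rewrite vmul_contract (eq_contract _ _ (skew_gl0 a b)) !(contractD, contractN).
rewrite (contract_sympl1r _ _ _ b (fun j => E a j)) //.
rewrite (contract_sympl1r _ _ _ a (fun j => E b j)) //.
rewrite (contract_sympl2r _ _ _ b (fun i => E i a)) //.
rewrite (contract_sympl2r _ _ _ a (fun i => E i b)) //.
by lmodule_ring.
Qed.

Lemma odd_odd0 a b c d : vmul Y (B a b) 0 (B c d) =
  om b c *: J a d - om a c *: J b d - om b d *: J a c + om a d *: J b c.
Proof.
have alphaA : vmul Y alpha 0 (A c d) = 0.
  by rewrite vmulDr vmulNr !trace_gl0 subr0.
have alpha2 : vmul Y alpha 0 alpha = 0.
  by rewrite vmul_contract [ctr _]big1 // => k _; rewrite trace_gl0 scaler0.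
rewrite vmulDl vmulNl vmulZl !(vmulDr _ _ _ (A c d)) !vmulNr !vmulZr.
rewrite skew_trace0 alphaA alpha2 vmulDr vmulNr !skew_gl0 /sp_current.
by lmodule_ring.
Qed.

Lemma odd_odd_gt0 (S : set V) a b c d (j : int) : is_subspace S -> S one ->
  0 < j -> S (vmul Y (B a b) j (B c d)).
Proof.
move=> hS vacS j0.
have hE k k' m m' : S (vmul Y (E k k') j (E m m')).
  have [->|j1] := eqVneq j 1.
    by rewrite (quad_quad1 h_comm); apply: (subspaceZ hS).
  by rewrite (quad_quad_gt1 h_comm); [apply: (subspace0 hS) | lia].
have hB k k' : S (vmul Y (E k k') j (B c d)).
  rewrite vmul_odd; apply: (subspaceB hS); first exact: (subspaceB hS).
  by apply: (subspaceZ hS); apply: (contract_closed _ _ hS).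
rewrite odd_vmul; apply: (subspaceB hS); first exact: (subspaceB hS).
by apply: (subspaceZ hS); apply: (contract_closed _ _ hS).
Qed.

Lemma odd_antisym a b : B b a = - B a b.
Proof. by rewrite /odd_current /skew_current (sympl_antisym rvK s_rv b); lmodule_ring. Qed.

Hypothesis cardI : (2 < #|I|)%N.
Let n0 : #|I|%:R != 0 :> F. Proof. by rewrite pnatr_eq0 -lt0n; lia. Qed.

Lemma odd_traceless : ctr B = 0.
Proof.
rewrite /odd_current !(contractD, contractN) (contractC rvK s_rv E).
rewrite (eq_contract _ _ (fun k k' => esym (scalerA (2 / #|I|%:R) (om k k') alpha))).
rewrite contractZ (contract_sympl rvK s_rv s2) scalerA divfK //.
by rewrite -/alpha; lmodule_ring.
Qed.

Local Notation E' a b := (vmul Y (h (true, a)) (-2) (h (false, b))).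
Local Notation E'' a b := (vmul Y (h (true, a)) (-1) (T (h (false, b)))).
Definition quart a b c d :=
  vmul Y (h (true, a)) (-1) (vmul Y (h (true, b)) (-1) (Q (false, c) (false, d))).

Lemma quartC12 a b c d : quart a b c d = quart b a c d.
Proof. by rewrite /quart (bosonN1C h_comm). Qed.
Lemma quartC34 a b c d : quart a b c d = quart a b d c.
Proof. by rewrite /quart (quadC h_comm). Qed.

Lemma sp_glN1 a b c d : vmul Y (J a b) (-1) (E c d) =
  quart c a b d + quart c b a d + om a d *: E'' c b + om b d *: E'' c a
  + om b c *: E' a d + om a c *: E' b d.
Proof.
rewrite vmulDl !(quad_quadN1 h_comm) -!/(quart _ _ _ _) /boson_pairing /=.
by lmodule_ring.
Qed.

Lemma contract_sym (f : I -> I -> V) : (forall i j, f i j = f j i) -> ctr f = 0.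
Proof.
move=> fC; have := contractC rvK s_rv f.
rewrite (eq_contract _ _ (fun i j => fC j i)) => /eqP; rewrite -subr_eq0 opprK -mulr2n.
by rewrite -scaler_nat scaler_eq0 pnatr_eq0 => /eqP.
Qed.

(** Contracting kills quartic terms symmetric in the contracted arguments; the others
are symmetric in c and d, and so is the contribution of the trace current.  The
antisymmetrization thus leaves quadratic terms, and these add up to T B. *)
Lemma odd_translation_formula c d :
  ctr (fun k k' => vmul Y (J c k) (-1) (B k' d) - vmul Y (J d k) (-1) (B k' c))
  = #|I|%:R *: T (B c d).
Proof.
pose q x y := ctr (fun k k' => quart k' x k y).
pose t' := ctr (fun k k' => E' k k').
pose t'' := ctr (fun k k' => E'' k k').
(* The contraction is computed separately on the two halves E(k', y) and E(y, k')
   of the skew current; q collects the quartic terms. *)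
have X x y : ctr (fun k k' => vmul Y (J x k) (-1) (E k' y)) =
    q x y - om x y *: t'' + E'' y x + #|I|%:R *: E' x y + E' x y.
  rewrite (eq_contract _ _ (fun k k' => sp_glN1 x k k' y)) !contractD.
  rewrite (contract_sym (f := fun k k' => quart k' k x y)) => [|? ?];
    last exact: quartC12.
  rewrite contractZ (contractC rvK s_rv (fun k k' => E'' k k')) -/t''.
  rewrite (contract_sympl1l rvK s_rv s2 y (fun k => E'' k x)).
  rewrite (contract_sympl rvK s_rv s2) (contract_sympl2r rvK s_rv s2 x (fun k => E' k y)).
  by rewrite -/(q x y); lmodule_ring.
have Z x y : ctr (fun k k' => vmul Y (J x k) (-1) (E y k')) =
    - q y x + om x y *: t' + E'' y x + #|I|%:R *: E'' y x + E' x y.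
  rewrite (eq_contract _ _ (fun k k' => sp_glN1 x k y k')) !contractD.
  rewrite (contract_sym (f := fun k k' => quart y x k k')) => [|? ?];
    last exact: quartC34.
  rewrite (eq_contract _ _ (fun k k' => quartC12 y k x k')).
  rewrite (eq_contract _ _ (fun k k' => quartC34 k y x k')).
  rewrite (contractC rvK s_rv (fun k k' => quart k' y k x)) -/(q y x).
  rewrite (contract_sympl2r rvK s_rv s2 x (fun k => E'' y k)) (contract_sympl rvK s_rv s2).
  rewrite contractZ -/t' (contract_sympl1l rvK s_rv s2 y (fun k => E' x k)).
  by lmodule_ring.
have JB x y : ctr (fun k k' => vmul Y (J x k) (-1) (B k' y)) =
    q x y + q y x - om x y *: (t' + t'')
    + #|I|%:R *: (E' x y - E'' y x) + (2 / #|I|%:R) *: vmul Y (J x y) (-1) alpha.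
  under (eq_contract rv s) => k k' do
    rewrite vmulDr vmulNr vmulDr vmulNr vmulZr mulrC -scalerA.
  rewrite !(contractD, contractN) X Z.
  rewrite (contract_sympl2l rvK s_rv s2 y (fun k => _ *: vmul Y (J x k) (-1) alpha)).
  by lmodule_ring.
have Talpha : T alpha = t' + t''.
  rewrite contract_vmul addrC -contractD.
  by apply: eq_contract => k k'; rewrite translation_quad.
rewrite contractD contractN !JB (_ : J d c = J c d); last by rewrite /sp_current addrC.
rewrite !vmulDl !vmulNl vmulZl Talpha !translation_quad (sympl_antisym rvK s_rv d c).
rewrite [RHS]scalerDr scalerN scalerA mulrA mulrCA divff // mulr1.
by lmodule_ring.
Qed.

End SymplecticBosons.

(** * Parity *)

(** The zero mode of a vector [z] is a derivation of all products, so that its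
eigenvalues add up under products. *)
Section ParityEigenspaces.
Variables (F : numFieldType) (V : lmodType F) (Y : vertex_algebra V) (z : V).
Local Notation D v := (vmul Y z 0 v).

Definition parity_part (r : int) : set V :=
  smallest (@is_subspace F V) [set v | exists k : int, D v = (2 * k + r)%:~R *: v].

Lemma parity_part_subspace r : is_subspace (parity_part r).
Proof.
apply/subspaceP; split=> [U [hU _]|a u v hu hv U hU]; first exact: subspace0.
have [hs _] := hU.
by apply: (subspaceD hs); [apply: (subspaceZ hs); apply: hu | apply: hv].
Qed.

Lemma parity_part_eigen r k v : D v = (2 * k + r)%:~R *: v -> parity_part r v.
Proof. by move=> Dv U [_]; apply; exists k. Qed.

Lemma parity_part_vmul r r' u n v :
  parity_part r u -> parity_part r' v -> parity_part (r + r') (vmul Y u n v).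
Proof.
have hS := parity_part_subspace (r + r').
move=> hu hv.
apply: (hu [set u | parity_part (r + r') (vmul Y u n v)]); split.
  apply/subspaceP; split=> [|a u1 u2 h1 h2].
    by rewrite /= vmul0l; apply: (subspace0 hS).
  by rewrite /= vmulDl vmulZl; apply: (subspaceD hS _ h2); apply: (subspaceZ hS).
move=> {u hu}u [k Du].
apply: (hv [set v | parity_part (r + r') (vmul Y u n v)]); split.
  apply/subspaceP; split=> [|a v1 v2 h1 h2].
    by rewrite /= vmul0r; apply: (subspace0 hS).
  by rewrite /= vmulDr vmulZr; apply: (subspaceD hS _ h2); apply: (subspaceZ hS).
move=> {v hv}v [k' Dv]; apply: (@parity_part_eigen _ (k + k')).
rewrite vmul0_derivation Du Dv vmulZl vmulZr -scalerDl -intrD.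
by congr (_%:~R *: _); lia.
Qed.

(** The product of the operators D - k for k in [c]. *)
Definition eigen_prod (c : seq int) (v : V) : V :=
  foldl (fun v k => D v - k%:~R *: v) v c.

Lemma eigen_prod_is_linear c a u v :
  eigen_prod c (a *: u + v) = a *: eigen_prod c u + eigen_prod c v.
Proof.
elim: c u v => //= k c IH u v; rewrite -IH vmulDr vmulZr; congr eigen_prod.
by lmodule_ring.
Qed.

Lemma eigen_prod0 c : eigen_prod c 0 = 0.
Proof. by elim: c => //= k c; rewrite vmul0r scaler0 subr0. Qed.

Lemma eigen_prodZ c a v : eigen_prod c (a *: v) = a *: eigen_prod c v.
Proof. by rewrite -[a *: v]addr0 eigen_prod_is_linear eigen_prod0 addr0. Qed.

Lemma eigen_prod_step c k v :
  eigen_prod c (D v - k%:~R *: v) = D (eigen_prod c v) - k%:~R *: eigen_prod c v.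
Proof.
elim: c v => //= k' c IH v; rewrite -IH; congr eigen_prod.
by rewrite !(vmulDr, vmulNr, vmulZr); lmodule_ring.
Qed.

Lemma eigen_prodC c c' v :
  eigen_prod c (eigen_prod c' v) = eigen_prod c' (eigen_prod c v).
Proof. by elim: c v => //= k c IH v; rewrite -eigen_prod_step IH. Qed.

Lemma parity_part_annihilator r v : parity_part r v ->
  exists c : seq int, eigen_prod [seq 2 * k + r | k <- c] v = 0.
Proof.
pose P := [set v | exists c : seq int, eigen_prod [seq 2 * k + r | k <- c] v = 0].
move=> hv; apply: (hv P); split.
  apply/subspaceP; split=> [|a u w [c hu] [c' hw]]; first by exists [::].
  exists (c ++ c'); rewrite map_cat /eigen_prod foldl_cat -!/(eigen_prod _ _).
  rewrite !eigen_prod_is_linear hu eigen_prod0 scaler0 add0r eigen_prodC hw.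
  exact: eigen_prod0.
by move=> w [k Dw]; exists [:: k]; rewrite /= Dw subrr.
Qed.

(** Products of D - k over even and over odd k are coprime polynomials in D, and a
vector killed by both is 0. *)
Lemma parity_part_disjoint v : parity_part 0 v -> parity_part 1 v -> v = 0.
Proof.
move=> /parity_part_annihilator[c hc] /parity_part_annihilator[c' hc'].
elim: c v hc hc' => [|k c IH] v //= hc hc'.
have Dv : D v = (2 * k + 0)%:~R *: v.
  apply/eqP; rewrite -subr_eq0; apply/eqP/IH => //.
  by rewrite eigen_prod_step hc' vmul0r scaler0 subr0.
elim: c' hc' {IH} => [|k' c' IH'] //=.
rewrite Dv -scalerBl -intrB eigen_prodZ => /eqP.
rewrite scaler_eq0 intr_eq0 => /orP[/eqP|/eqP //]; lia.
Qed.
End ParityEigenspaces.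

Section BosonParity.
Variables (F : numFieldType) (I : finType) (rv : I -> I) (s : I -> F).
Hypotheses (rvK : involutive rv) (s_rv : forall i, s (rv i) = - s i).
Hypothesis s2 : forall i, s i * s i = 1.
Local Notation om := (sympl rv s).
Local Notation ctr := (contract rv s).
Variables (V : lmodType F) (Y : vertex_algebra V) (h : bool * I -> V).
Hypothesis h_comm : forall x y (m n : int) v,
  vmul Y (h x) m (vmul Y (h y) n v) =
  vmul Y (h y) n (vmul Y (h x) m v)
  + (if m + n + 1 == 0 then boson_pairing rv s x y else 0) *: v.
Local Notation Q := (quad Y h).

Definition sum_boson i := h (true, i) + h (false, i).
Definition diff_boson i := h (true, i) - h (false, i).
(** Its zero mode preserves the span of the [diff_boson] and acts there by the signs
[s], so that it is odd on them; [s] has trace 0, as it must for an element of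
the symplectic Lie algebra. *)
Definition parity_vector : V :=
  4^-1 *: ctr (fun i j => s i *: vmul Y (diff_boson i) (-1) (diff_boson j)).
Local Notation D v := (vmul Y parity_vector 0 v).

Lemma diff_quad_boson0 i j x c :
  vmul Y (vmul Y (diff_boson i) (-1) (diff_boson j)) 0 (h (x, c)) =
  (-1) ^+ x *: (om j c *: diff_boson i + om i c *: diff_boson j).
Proof.
rewrite !(vmulDl, vmulNl, vmulDr, vmulNr) -!/(Q _ _).
rewrite !(quad_boson0 h_comm) /boson_pairing /diff_boson; case: x => /=; lmodule_ring.
Qed.

Lemma parity_boson0 x c : D (h (x, c)) = (- (-1) ^+ x / 2 * s c) *: diff_boson c.
Proof.
rewrite vmulZl contract_vmul.
transitivity (4^-1 *: ctr (fun i j =>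
    (-1) ^+ x *: (om j c *: (s i *: diff_boson i) - om i c *: (s j *: diff_boson j)))).
  congr (_ *: _); apply: eq_bigr => k _; congr (_ *: _).
  by rewrite vmulZl diff_quad_boson0 s_rv; lmodule_ring.
rewrite contractZ contractD contractN.
rewrite (contract_sympl2l rvK s_rv s2 c (fun i => s i *: diff_boson i)).
rewrite (contract_sympl1l rvK s_rv s2 c (fun i => s i *: diff_boson i)).
have -> : - (s c *: diff_boson c) - s c *: diff_boson c
    = (- (2 * s c)) *: diff_boson c by lmodule_ring.
by rewrite !scalerA; congr (_ *: _); field.
Qed.

Lemma parity_sum_boson c : D (sum_boson c) = 0.
Proof.
rewrite vmulDr !parity_boson0 -scalerDl (_ : _ + _ = 0) ?scale0r //=.
by field.
Qed.

Lemma parity_diff_boson c : D (diff_boson c) = s c *: diff_boson c.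
Proof.
rewrite vmulDr vmulNr !parity_boson0 -scalerBl; congr (_ *: _) => /=.
by field.
Qed.

Lemma sign_eq c : s c = 1 \/ s c = -1.
Proof.
have /eqP : (s c - 1) * (s c + 1) = 0 by rewrite -subr_sqr_1 expr2 s2 subrr.
by rewrite mulf_eq0 subr_eq0 addr_eq0 => /orP[]/eqP; [left|right].
Qed.

Lemma sum_boson_parity c : parity_part Y parity_vector 0 (sum_boson c).
Proof. by apply: (@parity_part_eigen _ _ _ _ _ 0); rewrite parity_sum_boson scale0r. Qed.

Lemma diff_boson_parity c :
  parity_part Y parity_vector 1 (diff_boson c)
  /\ parity_part Y parity_vector (-1) (diff_boson c).
Proof.
have := parity_diff_boson c; have [->|->] := sign_eq c => Dq; split.
- by apply: (@parity_part_eigen _ _ _ _ _ 0); rewrite Dq.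
- by apply: (@parity_part_eigen _ _ _ _ _ 1); rewrite Dq.
- by apply: (@parity_part_eigen _ _ _ _ _ (-1)); rewrite Dq.
- by apply: (@parity_part_eigen _ _ _ _ _ 0); rewrite Dq.
Qed.

(** 2 J(a, b) = p_a p_b - q_a q_b, with p and q the sums and differences of bosons. *)
Lemma sp_parity a b : parity_part Y parity_vector 0 (sp_current Y h a b).
Proof.
have hS := parity_part_subspace Y parity_vector 0.
apply: (@subspace_scaleI _ _ _ hS 2); first by rewrite pnatr_eq0.
have hp := parity_part_vmul (-1) (sum_boson_parity a) (sum_boson_parity b).
have hq := parity_part_vmul (-1) (proj1 (diff_boson_parity a))
             (proj2 (diff_boson_parity b)).
have := subspaceB hS hp hq; congr (parity_part _ _ _ _).
rewrite !(vmulDl, vmulNl, vmulDr, vmulNr) -!/(Q _ _) /sp_current /gl_current.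
by rewrite (quadC h_comm (true, b)); lmodule_ring.
Qed.

(** 2 A(a, b) = q_a p_b - p_a q_b. *)
Lemma skew_parity a b : parity_part Y parity_vector 1 (skew_current Y h a b).
Proof.
have hS := parity_part_subspace Y parity_vector 1.
apply: (@subspace_scaleI _ _ _ hS 2); first by rewrite pnatr_eq0.
have hp := parity_part_vmul (-1) (sum_boson_parity a) (proj1 (diff_boson_parity b)).
have hq := parity_part_vmul (-1) (proj1 (diff_boson_parity a)) (sum_boson_parity b).
have := subspaceB hS hq hp; congr (parity_part _ _ _ _).
rewrite !(vmulDl, vmulNl, vmulDr, vmulNr) -!/(Q _ _) /skew_current /gl_current.
by rewrite (quadC h_comm (true, b)); lmodule_ring.
Qed.
End BosonParity.

(** * The Weyl vertex algebra *)
Section WeylRealization.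
Variables (F : numFieldType) (l : nat) (hl : (2 <= l)%N).
Variable M : weyl_vertex_algebra F (2 * l).
Local Notation Y := (weyl_va M).
Local Notation one := (vac Y).
Local Notation I := 'I_(2 * l).
Local Notation rv := (@rev_ord (2 * l)).

Definition weyl_sign (i : I) : F := if (i < l)%N then 1 else -1.
Local Notation s := weyl_sign.

Lemma weyl_sign_small (i : I) : (i < l)%N -> s i = 1.
Proof. by rewrite /weyl_sign => ->. Qed.
Lemma rev_small (i : I) : (rv i < l)%N = ~~ (i < l)%N.
Proof. by rewrite /=; have := ltn_ord i; lia. Qed.
Lemma weyl_sign_rev i : s (rv i) = - s i.
Proof. by rewrite /weyl_sign rev_small; case: (i < l)%N; rewrite ?opprK. Qed.
Lemma weyl_sign_sqr i : s i * s i = 1.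
Proof. by rewrite /weyl_sign; case: (i < l)%N; rewrite ?mulrNN mulr1. Qed.
Let rvK : involutive rv := @rev_ordK _.
Let cardI : (2 < #|I|)%N. Proof. by rewrite card_ord; lia. Qed.

(** The a_i^- are renumbered and given signs so that their pairing with the a_i^+
becomes the symplectic form. *)
Definition weyl_boson (x : bool * I) : M :=
  if x.1 then wp x.2 (-1) one else s x.2 *: wm (rv x.2) (-1) one.
Local Notation h := weyl_boson.

Lemma weyl_boson_comm x y (m n : int) v :
  vmul Y (h x) m (vmul Y (h y) n v) =
  vmul Y (h y) n (vmul Y (h x) m v)
  + (if m + n + 1 == 0 then boson_pairing rv s x y else 0) *: v.
Proof.
have pm i j p q w : wp i p (wm (rv j) q w) =
    wm (rv j) q (wp i p w) + (if (p + q + 1 == 0) && (i == rv j) then w else 0).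
  by rewrite -weyl_comm_pm addrC subrK.
rewrite /boson_pairing /sympl; case: x y => [[] i] [[] j] /=; rewrite ?if_same;
  rewrite ?vmulZl ?vmulZr ?weyl_fieldp ?weyl_fieldm ?vmulZr ?weyl_fieldp ?weyl_fieldm.
- by rewrite weyl_comm_pp scale0r addr0.
- rewrite pm scalerDr; congr (_ + _).
  by case: eqP; case: eqP => _ _; rewrite ?scale0r ?scaler0.
- rewrite pm scalerDr -addrA -[LHS]addr0; congr (_ + _).
  have -> : (i == rv j) = (j == rv i) by rewrite -(inj_eq (inv_inj rvK)) rvK eq_sym.
  rewrite (addrC n); case: (_ == 0); last by rewrite scaler0 scale0r addr0.
  case: (j =P rv i) => [->|_] /=; last by rewrite scaler0 scale0r addr0.
  by rewrite weyl_sign_rev scaleNr subrr.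
- by rewrite weyl_comm_mm scale0r addr0 !scalerA mulrC.
Qed.

Local Notation E := (gl_current Y h).
Local Notation J := (sp_current Y h).
Local Notation A := (skew_current Y h).
Local Notation B := (odd_current rv s Y h).

Lemma qpmE i j : qpm M i j = - s j *: E i (rv j).
Proof.
rewrite /gl_current /quad /weyl_boson /= vmulZr weyl_fieldp rvK weyl_sign_rev.
by rewrite scalerA mulrNN weyl_sign_sqr scale1r.
Qed.

Lemma qmpE i j : qmp M i j = qpm M j i.
Proof.
have := weyl_comm_pm j i (-1) (-1) one.
by rewrite (_ : -1 - 1 + 1 == 0 = false) //= => /eqP; rewrite subr_eq0 => /eqP.
Qed.

Lemma sp_currentC i j : J j i = J i j. Proof. by rewrite /sp_current addrC. Qed.

Lemma sympl_rev_neq i j : i != j -> sympl rv s i (rv j) = 0.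
Proof. by rewrite /sympl rvK => /negbTE->. Qed.

Lemma neq_rev (i j : I) : (i < l)%N -> (j < l)%N -> i != rv j.
Proof. by move=> il jl; apply/eqP => ij; move: il; rewrite ij rev_small jl. Qed.

Lemma sp_current_rev i j : J i (rv j) = s i *: qpm M (rv j) (rv i) - s j *: qpm M i j.
Proof.
rewrite !qpmE rvK !weyl_sign_rev /sp_current !scalerA !(mulrN, mulNr).
rewrite !weyl_sign_sqr opprK.
by rewrite !(scaleN1r, scale1r) opprK; lmodule_ring.
Qed.

(** Up to scalars the generators are the J(a, b) with b different from rv a; the
Cartan elements J(a, rv a) are brackets of long root vectors. *)
Lemma LC_gen : LC M = vertex_subalgebra_gen Y [set v | exists i j, v = J i j].
Proof.
have hC := vertex_subalgebra_genP Y (@genC_long _ _ M `|` @genC_short _ _ M).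
have [hC0 _ vmulC] := hC.
have hJ := vertex_subalgebra_genP Y [set v | exists i j, v = J i j].
have [hJ0 _ vmulJ] := hJ.
have JJ i j : vertex_subalgebra_gen Y [set v | exists i j, v = J i j] (J i j).
  by move=> U [_]; apply; exists i, j.
have Clong (i : I) : (i < l)%N -> LC M (qpm M i (rv i)) /\ LC M (qmp M i (rv i)).
  by move=> il; split=> U [_]; apply; left; exists i; split=> //; [left|right].
have Cshort (i j : I) v : (i < j)%N -> (j < l)%N ->
    [\/ v = 2^-1 *: (qpm M i (rev_ord j) + qpm M j (rev_ord i)),
        v = 2^-1 *: (qmp M i (rev_ord j) + qmp M j (rev_ord i)),
        v = 2^-1 *: (qpm M i j - qpm M (rev_ord j) (rev_ord i)) |
        v = 2^-1 *: (qpm M j i - qpm M (rev_ord i) (rev_ord j))] -> LC M v.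
  by move=> ij jl hv U [_]; apply; right; exists i, j.
have half_ne0 : 2^-1 != 0 :> F by rewrite invr_eq0 pnatr_eq0.
apply/seteqP; split; apply: smallest_sub => //.
  move=> v [[i [il]]|[i [j [ij jl]]]].
    have := JJ i i; have := JJ (rv i) (rv i).
    rewrite /sp_current => h1 h2 [->|->].
      rewrite qpmE rvK weyl_sign_rev opprK; apply: (subspaceZ hJ0).
      apply: (subspace_scaleI hJ0 (_ : 2 != 0)); first by rewrite pnatr_eq0.
      by rewrite scaler_nat mulr2n.
    rewrite qmpE qpmE; apply: (subspaceZ hJ0).
    apply: (subspace_scaleI hJ0 (_ : 2 != 0)); first by rewrite pnatr_eq0.
    by rewrite scaler_nat mulr2n.
  have il : (i < l)%N by apply: ltn_trans ij jl.
  rewrite !qmpE !qpmE !rvK !weyl_sign_rev !(weyl_sign_small il).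
  rewrite !(weyl_sign_small jl) !opprK !scale1r !scaleN1r -!opprD.
  move=> -[]->; apply: (subspaceZ hJ0).
  - exact: JJ.
  - by apply: (subspaceN hJ0); apply: JJ.
  - by apply: (subspaceN hJ0); apply: JJ.
  - by apply: (subspaceN hJ0); apply: JJ.
have Jsmall (i j : I) : (i < j)%N -> (j < l)%N ->
    [/\ LC M (J i j), LC M (J (rv i) (rv j)), LC M (J i (rv j)) & LC M (J j (rv i))].
  move=> ij jl; have il : (i < l)%N by apply: ltn_trans ij jl.
  split; apply: (subspace_scaleI hC0 half_ne0).
  - apply: (Cshort i j) => //; apply: Or41.
    rewrite !qpmE !rvK !weyl_sign_rev (weyl_sign_small il) (weyl_sign_small jl).
    by rewrite opprK !scale1r.
  - rewrite -[_ *: _]opprK; apply: (subspaceN hC0).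
    apply: (Cshort i j) => //; apply: Or42.
    rewrite !qmpE !qpmE (weyl_sign_small il) (weyl_sign_small jl) !scaleN1r /sp_current.
    by lmodule_ring.
  - rewrite -[_ *: _]opprK; apply: (subspaceN hC0).
    apply: (Cshort i j) => //; apply: Or43.
    by rewrite sp_current_rev (weyl_sign_small il) (weyl_sign_small jl); lmodule_ring.
  - rewrite -[_ *: _]opprK; apply: (subspaceN hC0).
    apply: (Cshort i j) => //; apply: Or44.
    by rewrite sp_current_rev (weyl_sign_small il) (weyl_sign_small jl); lmodule_ring.
have Jdiag (i : I) : (i < l)%N ->
    [/\ LC M (J i i), LC M (J (rv i) (rv i)) & LC M (J i (rv i))].
  move=> il; have [h1 h2] := Clong i il.
  have J1 : LC M (J i i).
    have := subspaceZ hC0 2 h1.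
    rewrite qpmE rvK weyl_sign_rev (weyl_sign_small il) opprK scale1r.
    by rewrite scaler_nat mulr2n.
  have J2 : LC M (J (rv i) (rv i)).
    have := subspaceZ hC0 (- 2) h2.
    rewrite qmpE qpmE (weyl_sign_small il) scaleN1r scalerN scaleNr opprK.
    by rewrite scaler_nat mulr2n.
  split=> //; have := vmulC _ _ 0 J1 J2.
  rewrite vmulDr !(sp_quad0 weyl_boson_comm) -!/(E _ _).
  rewrite /sympl !rvK !eqxx weyl_sign_rev (weyl_sign_small il).
  move=> h3; apply: (subspace_scaleI hC0 (_ : - 4 != 0)).
    by rewrite oppr_eq0 pnatr_eq0.
  by move: h3; congr (LC M _); rewrite /sp_current; lmodule_ring.
have Jall (i j : I) : (i < l)%N -> (j < l)%N ->
    [/\ LC M (J i j), LC M (J (rv i) (rv j)) & LC M (J i (rv j))].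
  move=> il jl; have [ij|ji|/val_inj->] := ltngtP i j; last exact: Jdiag.
    by have [] := Jsmall i j ij jl.
  by have [] := Jsmall j i ji il; rewrite (sp_currentC i) (sp_currentC (rv i)).
move=> _ [i [j ->]].
have [il|il] := boolP (i < l)%N; have [jl|jl] := boolP (j < l)%N.
- by have [] := Jall i j il jl.
- by have [_ _] := Jall i (rv j) il ltac:(by rewrite rev_small); rewrite rvK.
- rewrite sp_currentC.
  by have [_ _] := Jall j (rv i) jl ltac:(by rewrite rev_small); rewrite rvK.
- have [_ + _] := Jall (rv i) (rv j) ltac:(by rewrite rev_small)
                    ltac:(by rewrite rev_small).
  by rewrite !rvK.
Qed.

Let hLA : is_vertex_subalgebra Y (LA M). Proof. exact: vertex_subalgebra_genP. Qed.
Let hLA0 : is_subspace (LA M). Proof. by case: hLA. Qed.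

Lemma LA_qpm i j : i != j -> LA M (qpm M i j).
Proof.
move=> ij U [_]; apply; have [h1|h1|/val_inj h1] := ltngtP i j.
- by exists i, j; split=> //; left.
- by exists j, i; split=> //; right; rewrite qmpE.
- by rewrite h1 eqxx in ij.
Qed.

Lemma LC_sub_LA : LC M `<=` LA M.
Proof.
apply: smallest_sub => // v [[i [il hv]]|[i [j [ij jl hv]]]].
  have ii := neq_rev il il.
  by case: hv => ->; rewrite ?qmpE; apply: LA_qpm; rewrite // eq_sym.
have il : (i < l)%N by apply: ltn_trans ij jl.
have nij : i != j by rewrite -val_eqE /= neq_ltn ij.
have nij' := neq_rev il jl.
have nji' := neq_rev jl il.
have nrr : rv i != rv j by rewrite (inj_eq (inv_inj rvK)).
rewrite !qmpE in hv.
case: hv => ->; apply: (subspaceZ hLA0);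
  first [apply: (subspaceB hLA0) | apply: (subspaceD hLA0)];
  by apply: LA_qpm; rewrite // eq_sym.
Qed.

Let i1 : I := Ordinal (lt0_2l hl).
Let i2 : I := Ordinal (lt1_2l hl).
Let i1l : (i1 < l)%N. Proof. exact: ltn_trans _ hl. Qed.
Let i2l : (i2 < l)%N. Proof. exact: hl. Qed.
Let i21 : i2 != i1. Proof. by []. Qed.
Let i21' : i2 != rv i1. Proof. exact: neq_rev. Qed.

Lemma estarE : estar M hl = 2^-1 *: B i1 i2.
Proof.
rewrite /estar -/i1 -/i2 !qpmE !rvK !weyl_sign_rev (weyl_sign_small i1l).
rewrite (weyl_sign_small i2l) opprK !scale1r.
by rewrite /odd_current /sympl (negbTE (neq_rev i1l i2l)) mulr0 scale0r subr0.
Qed.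

Lemma LA_estar : LA M (estar M hl).
Proof.
apply: (subspaceZ hLA0); apply: (subspaceB hLA0); apply: LA_qpm; exact: neq_rev.
Qed.

Let half_neq0 : 2^-1 != 0 :> F. Proof. by rewrite invr_eq0 pnatr_eq0. Qed.

Let hLC : is_vertex_subalgebra Y (LC M). Proof. exact: vertex_subalgebra_genP. Qed.
Let hLC0 : is_subspace (LC M). Proof. by case: hLC. Qed.

Lemma LC_sp_current i j : LC M (J i j).
Proof. by rewrite LC_gen => U [_]; apply; exists i, j. Qed.

Lemma odd_odd_ge0 a b c d (j : int) : 0 <= j -> LC M (vmul Y (B a b) j (B c d)).
Proof.
rewrite le_eqVlt => /orP[/eqP<-|]; last first.
  by case: hLC => ? ? _; apply: (odd_odd_gt0 weyl_boson_comm).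
rewrite (odd_odd0 rvK weyl_sign_rev weyl_sign_sqr weyl_boson_comm).
by do ! first [apply: (subspaceB hLC0) | apply: (subspaceD hLC0)];
  apply: (subspaceZ hLC0); apply: LC_sp_current.
Qed.

Lemma LA_sum : LA M = [set u + v | u in LC M & v in LC2 M hl].
Proof.
have e1 := odd_antisym rvK weyl_sign_rev Y h.
have e2 := odd_traceless rvK weyl_sign_rev weyl_sign_sqr Y h cardI.
have e3 := sp_odd0 rvK weyl_sign_rev weyl_sign_sqr weyl_boson_comm.
have e4 := sp_odd_gt0 rvK weyl_sign_rev weyl_sign_sqr weyl_boson_comm.
have e5 := odd_translation_formula rvK weyl_sign_rev weyl_sign_sqr
             weyl_boson_comm cardI.
have hU := extension_subalgebra rvK weyl_sign_rev weyl_sign_sqr cardI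
  e1 e2 e3 e4 e5 LC_gen hLA LC_sub_LA LA_estar half_neq0 estarE i21 i21' odd_odd_ge0.
have hB := odd_submodule_gens rvK weyl_sign_rev weyl_sign_sqr cardI
  e1 e2 e3 LC_gen hLA LC_sub_LA LA_estar half_neq0 estarE i21 i21'.
apply/seteqP; split; last first.
  move=> _ [u /LC_sub_LA hu [v hv <-]]; apply: (subspaceD hLA0) => //.
  apply: hv; split; last by move=> _ ->; exact: LA_estar.
  by case: hLA => _ _ ?; split=> // u' v' n /LC_sub_LA ?; auto.
have [hU0 _ _] := hU.
have Uq i j : i != j -> [set u + v | u in LC M & v in LC2 M hl] (qpm M i j).
  move=> ij; rewrite qpmE; apply: (subspaceZ hU0).
  apply: (subspace_scaleI hU0 (_ : 2 != 0)); first by rewrite pnatr_eq0.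
  exists (J i (rv j)); first exact: LC_sp_current.
  exists (B i (rv j)); first exact: hB.
  rewrite /odd_current sympl_rev_neq // mulr0 scale0r subr0.
  by rewrite /sp_current /skew_current; lmodule_ring.
apply: smallest_sub => // v [i [j [ij]]].
have nij : i != j by rewrite -val_eqE /= neq_ltn ij.
by case=> ->; rewrite ?qmpE; apply: Uq; rewrite // eq_sym.
Qed.

Lemma LC2_ind (P : set M) : is_subspace P -> P (estar M hl) ->
  (forall i j n v, P v -> P (vmul Y (J i j) n v)) -> LC2 M hl `<=` P.
Proof.
move=> hP Pe JP; apply: (odd_ind hLA LC_sub_LA LA_estar hP Pe) => u n v.
exact: (even_stable LC_gen hP JP).
Qed.

Lemma LC_LC2_disjoint : LC M `&` LC2 M hl = [set 0].
Proof.
pose P r := parity_part Y (parity_vector rv s Y h) r.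
have hP r : is_subspace (P r) := parity_part_subspace _ _ _.
have JP := sp_parity rvK weyl_sign_rev weyl_sign_sqr weyl_boson_comm.
apply/seteqP; split=> [v [Cv C2v]|_ ->]; last first.
  split; first exact: (subspace0 hLC0).
  by move=> N [[hN _ _] _]; apply: (subspace0 hN).
apply: (@parity_part_disjoint _ _ Y (parity_vector rv s Y h)).
  move: v Cv {C2v}; rewrite LC_gen; apply: smallest_sub.
    split; first exact: (hP 0).
      by apply: (@parity_part_eigen _ _ _ _ _ 0); rewrite vmul_vacr_ge0 // scale0r.
    move=> u v n; rewrite -[X in parity_part _ _ X (vmul _ _ _ _)](addr0 0).
    exact: parity_part_vmul.
  by move=> _ [i [j ->]]; apply: JP.
move: v C2v {Cv}; apply: LC2_ind; first exact: hP.
  rewrite estarE; apply: (subspaceZ (hP 1)).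
  rewrite /odd_current /sympl (negbTE (neq_rev i1l i2l)) mulr0 scale0r subr0.
  exact: (skew_parity rvK weyl_sign_rev weyl_sign_sqr weyl_boson_comm).
by move=> i j n v hv; rewrite -[1](add0r 1); apply: parity_part_vmul.
Qed.

Section Theta.
Variable theta : {linear M -> M}.
Hypothesis hth : is_theta theta.

Let th_vac : theta one = one. Proof. by case: hth => -[]. Qed.
Let th_vmul u n v : theta (vmul Y u n v) = vmul Y (theta u) n (theta v).
Proof. by case: hth => -[]. Qed.

(** The signs merge the cases i < l and i >= l of the definition of theta. *)
Lemma theta_wp i n v : theta (wp i n v) = s i *: wm (rv i) n (theta v).
Proof.
have [_ th] := hth; have [il|il] := boolP (i < l)%N.
  by have [-> _ _ _] := th i n v il; rewrite weyl_sign_small // scale1r.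
have [_ _ _] := th (rv i) n v ltac:(by rewrite rev_small).
by rewrite rvK /weyl_sign (negbTE il) scaleN1r.
Qed.

Lemma theta_wm i n v : theta (wm i n v) = - s i *: wp (rv i) n (theta v).
Proof.
have [_ th] := hth; have [il|il] := boolP (i < l)%N.
  by have [_ _ -> _] := th i n v il; rewrite weyl_sign_small // scaleN1r.
have [_ + _ _] := th (rv i) n v ltac:(by rewrite rev_small).
by rewrite rvK /weyl_sign (negbTE il) opprK scale1r.
Qed.

(** So theta is minus the adjoint for the symplectic form, the involution of gl whose
fixed points form sp. *)
Lemma theta_E i j : theta (E i j) = E j i.
Proof.
have -> : E i j = s j *: qpm M i (rv j).
  by rewrite qpmE rvK weyl_sign_rev opprK scalerA weyl_sign_sqr scale1r.
rewrite linearZ theta_wp theta_wm th_vac rvK linearZ /= -/(qmp M (rv i) j) qmpE qpmE.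
rewrite rvK !weyl_sign_rev !opprK !scalerA.
have -> : s j * s i * s j * s i = (s i * s i) * (s j * s j) by ring.
by rewrite !weyl_sign_sqr mulr1 scale1r.
Qed.

Lemma LC_fixed v : LC M v -> theta v = v.
Proof.
rewrite LC_gen; move: v; apply: smallest_sub.
  split=> //.
    apply/subspaceP; split=> [|a u v hu hv]; first exact: linear0.
    by rewrite /= linearP hu hv.
  by move=> u v n hu hv; rewrite /= th_vmul hu hv.
by move=> _ [i [j ->]]; rewrite /= linearD !theta_E addrC.
Qed.

Lemma LC2_anti v : LC2 M hl v -> theta v = - v.
Proof.
move: v; apply: (@LC2_ind [set v | theta v = - v]).
- apply/subspaceP; split=> [|a u v hu hv]; first by rewrite /= linear0 oppr0.
  by rewrite /= linearP hu hv scalerN opprD.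
- rewrite /= estarE /odd_current /sympl (negbTE (neq_rev i1l i2l)) mulr0 scale0r subr0.
  by rewrite linearZ linearB /= !theta_E -scalerN opprB.
- move=> i j n v hv.
  by rewrite /= th_vmul hv (LC_fixed (LC_sp_current i j)) vmulNr.
Qed.
End Theta.
End WeylRealization.

Theorem theorem5 (R : realType) (l : nat) (hl : (2 <= l)%N)
    (M : weyl_vertex_algebra R[i] (2 * l)) :
  is_direct_sum (LA M) (LC M) (LC2 M hl) /\
  (forall theta : {linear M -> M}, is_theta theta ->
     LC M = fixed_part theta (LA M) /\ LC2 M hl = anti_part theta (LA M)).
Proof.
split; first by split; [exact: LA_sum | exact: LC_LC2_disjoint].
move=> theta hth.
have LAP w : LA M w -> exists u v, [/\ LC M u, LC2 M hl v & w = u + v].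
  by rewrite (LA_sum hl) => -[u hu [v hv <-]]; exists u, v.
have sub0 u v : LC M u -> LC2 M hl v -> LA M (u + v).
  by rewrite (LA_sum hl) => hu hv; exists u => //; exists v.
have [/subspace0 C0 _ _] := vertex_subalgebra_genP (weyl_va M)
  (@genC_long _ _ M `|` @genC_short _ _ M).
have C20 : LC2 M hl 0 by move=> N [[/subspace0]].
have two0 : 2%:R != 0 :> R[i] by rewrite pnatr_eq0.
have self_opp (v : M) : v = - v -> v = 0.
  move/eqP; rewrite -subr_eq0 opprK -mulr2n -scaler_nat scaler_eq0 (negbTE two0).
  by move/eqP.
split; apply/seteqP; split=> w.
- move=> hw; split; last exact: LC_fixed hth _ hw.
  by rewrite -[w]addr0; apply: sub0.
- move=> [/LAP[u [v [hu hv ->]]]].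
  rewrite linearD (LC_fixed hl hth hu) (LC2_anti hth hv) => /addrI /esym/self_opp->.
  by rewrite addr0.
- move=> hw; split; last exact: LC2_anti hth _ hw.
  by rewrite -[w]add0r; apply: sub0.
- move=> [/LAP[u [v [hu hv ->]]]].
  rewrite linearD (LC_fixed hl hth hu) (LC2_anti hth hv) opprD => /addIr /self_opp->.
  by rewrite add0r.
Qed.
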